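(* Let $N\geq 5$, $0<R\leq\infty$, and let $W_{2}$ be a smooth function on $(0,R)$. Then: (1) If $(1,W_{2})$ is an $(N+2)$-dimensional Bessel pair on $(0,R)$, then for all $u\in C_{0}^{\infty}(B_{R}\setminus\{0\})$, $$\int_{B_{R}}|\Delta u|^{2}\,dx\geq\int_{B_{R}}W_{2}(|x|)\,|\nabla u|^{2}\,dx.$$ (2) If $(1,W_{2})$ is an $N$-dimensional Bessel pair on $(0,R)$, then for all $u\in C_{0}^{\infty}(B_{R}\setminus\{0\})$, $$\int_{B_{R}}|\Delta u|^{2}\,dx\geq\int_{B_{R}}W_{2}(|x|)\,|\nabla u|^{2}\,dx+(N-1)\int_{B_{R}}\frac{|\nabla u|^{2}}{|x|^{2}}\,dx.$$
   Context: $B_R$ is the open ball of radius $R$ centered at the origin in $\mathbb{R}^N$ (with $B_\infty=\mathbb{R}^N$). $C_0^\infty(\Omega)$ is the space of smooth functions with compact support in $\Omega$. For an integer $n\ge 1$, a pair $(V,W)$ of functions on $(0,R)$ (with $V\ge 0$ and $W$ of arbitrary sign) is an $n$-dimensional Bessel pair on $(0,R)$ if there exists a positive function $\varphi$ on $(0,R)$ such that $\left(r^{n-1}V\varphi'\right)'+r^{n-1}W\varphi=0$ on $(0,R)$. *)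

(* Defs.v *)
From HB Require Import structures.
From mathcomp Require Import all_boot all_order all_algebra.
From mathcomp Require Import all_classical all_reals all_analysis.

Set Implicit Arguments.
Unset Strict Implicit.
Unset Printing Implicit Defensive.

Import Order.TTheory GRing.Theory Num.Theory.
Import numFieldNormedType.Exports.

Local Open Scope ring_scope.
Local Open Scope classical_set_scope.

(* 'rV[R]_n carries the product (i.e. Borel) sigma-algebra: the one generated
   by the coordinate functions *)
Definition rV_display : measure_display. Proof. exact. Qed.

Section measurable_rV.
Context {R : realType} {n : nat}.

Let coord (i : 'I_n) (x : 'rV[R]_n) : measurableTypeR R := x ord0 i.

Let rV_set0 : g_sigma_preimage coord set0.
Proof. exact: sigma_algebra0. Qed.

Let rV_setC A : g_sigma_preimage coord A -> g_sigma_preimage coord (~` A).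
Proof. exact: sigma_algebraC. Qed.

Let rV_bigcup (F : _^nat) : (forall i, g_sigma_preimage coord (F i)) ->
  g_sigma_preimage coord (\bigcup_i (F i)).
Proof. exact: sigma_algebra_bigcup. Qed.

HB.instance Definition _ := @isMeasurable.Build rV_display
  'rV[R]_n (g_sigma_preimage coord) rV_set0 rV_setC rV_bigcup.

Lemma measurable_coord (i : 'I_n) :
  measurable_fun [set: 'rV[R]_n] (fun x => x ord0 i : measurableTypeR R).
Proof.
move=> _ Y mY; rewrite setTI; apply: sub_sigma_algebra => /=.
rewrite -bigcup_seq/=; exists i => /=; first by rewrite mem_index_enum.
by exists Y => //; rewrite setTI.
Qed.

Lemma measurable_fun_rVP d (T : measurableType d) (f : T -> 'rV[R]_n) :
  measurable_fun [set: T] f <->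
  forall i, measurable_fun [set: T] (fun t => f t ord0 i : measurableTypeR R).
Proof.
split=> [mf i|mf].
  by apply: (measurableT_comp (measurable_coord i)).
suff H : g_sigma_preimage coord `<=` [set A | measurable (f @^-1` A)].
  by move=> _ A mA; rewrite setTI; exact: H.
apply: smallest_sub.
  split => /=.
  - by rewrite preimage_set0.
  - by move=> A mA; rewrite setTD -preimage_setC; apply: measurableC.
  - by move=> F mF; rewrite preimage_bigcup; apply: bigcupT_measurable.
move=> A; rewrite -bigcup_seq/= => -[i _ [B mB <-]] /=.
by rewrite setTI -[X in measurable X]setTI; apply: mf.
Qed.

End measurable_rV.

Section lebesgue_rV.
Context {R : realType}.

Definition cons_rV n (p : measurableTypeR R * 'rV[R]_n) : 'rV[R]_n.+1 :=
  \row_i oapp (p.2 ord0) p.1 (unlift ord0 i).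

Lemma measurable_cons_rV n : measurable_fun setT (@cons_rV n).
Proof.
apply/measurable_fun_rVP => i.
have [j ->|->] := unliftP ord0 i.
  rewrite (_ : (fun t => _) =
    (fun x : 'rV[R]_n => x ord0 j : measurableTypeR R) \o snd); last first.
    by apply/funext => t /=; rewrite mxE liftK.
  exact: measurableT_comp (measurable_coord j) measurable_snd.
rewrite (_ : (fun t => _) = fst) //.
by apply/funext => t /=; rewrite mxE unlift_none.
Qed.

(* Lebesgue measure on R^n (restricted to Borel sets), as the n-fold product of
   the Lebesgue measure on R; lebesgue_rV_box gives its value on boxes *)
Fixpoint lebesgue_rV n : set 'rV[R]_n -> \bar R :=
  if n is m.+1 return set 'rV[R]_n -> \bar R then
    pushforward (@lebesgue_measure R \x @lebesgue_rV m)%E (@cons_rV m)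
  else \d_(0 : 'rV[R]_0).

Definition box n (A : 'I_n -> set R) : set 'rV[R]_n :=
  [set x | forall i, A i (x ord0 i)].

Lemma measurable_box n (A : 'I_n -> set (measurableTypeR R)) :
  (forall i, measurable (A i)) -> measurable (box A).
Proof.
move=> mA.
rewrite (_ : box A =
    \big[setI/setT]_(i < n) ((fun x : 'rV[R]_n => x ord0 i) @^-1` A i)).
  apply: bigsetI_measurable => i _; rewrite -[X in measurable X]setTI.
  exact: measurable_coord.
rewrite -bigcap_seq; apply/seteqP; split=> x /= h i.
  by move=> _; exact: h.
by apply: h; rewrite /= mem_index_enum.
Qed.

Lemma preimage_cons_rV_box n (A : 'I_n.+1 -> set R) :
  @cons_rV n @^-1` box A = A ord0 `*` box (fun i => A (lift ord0 i)).
Proof.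
apply/seteqP; split=> -[a x] /=.
  move=> h; split=> /= [|i].
    by have := h ord0; rewrite mxE unlift_none.
  by have := h (lift ord0 i); rewrite mxE liftK.
move=> -[/= Aa Ax] i; rewrite mxE.
by have [j ->|->] := unliftP ord0 i; rewrite ?liftK ?unlift_none//=; exact: Ax.
Qed.

Let cube n (k : nat) : set 'rV[R]_n := box (fun=> `]- k%:R, k%:R]%classic).

Let measurable_cube n k : measurable (@cube n k).
Proof. by apply: measurable_box => i; exact: measurable_itv. Qed.

Let bigcup_cube n : \bigcup_k @cube n k = [set: 'rV[R]_n].
Proof.
apply/seteqP; split=> // x _.
exists (Num.truncn `|x|).+1 => //= i.
have xk : `|x ord0 i| < (Num.truncn `|x|).+1%:R.
  apply: le_lt_trans (truncnS_gt _).
  rewrite [leRHS]/Num.Def.normr/= mx_normrE.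
  exact: (le_bigmax _ (fun ij : 'I_1 * 'I_n => `|x ij.1 ij.2|) (ord0, i)).
by move: xk; rewrite ltr_norml /cube/= in_itv/= => /andP[-> /ltW ->].
Qed.

Section step.
Variables (n : nat) (m : {sigma_finite_measure set 'rV[R]_n -> \bar R}).
Hypothesis mfin : forall k, (m (@cube n k) < +oo)%E.

Let mu := pushforward (@lebesgue_measure R \x m)%E (@cons_rV n).

Let mu0 : mu set0 = 0%E.
Proof. by rewrite /mu /pushforward preimage_set0 measure0. Qed.

Let mu_ge0 A : (0 <= mu A)%E.
Proof. by rewrite /mu /pushforward measure_ge0. Qed.

Let mu_sigma_additive : semi_sigma_additive mu.
Proof.
exact: (@measure_semi_sigma_additive _ _ _
  (measure_function_pushforward__canonical__measure_function_Measure
    (@lebesgue_measure R \x m)%E (@measurable_cons_rV n))).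
Qed.

#[local] HB.instance Definition _ := isMeasure.Build _ _ _ mu
  mu0 mu_ge0 mu_sigma_additive.

Let mu_cube k : (mu (@cube n.+1 k) < +oo)%E.
Proof.
rewrite /mu /pushforward preimage_cons_rV_box.
rewrite product_measure1E; last 2 first.
- exact: measurable_itv.
- exact: measurable_cube.
apply: lte_mul_pinfty.
- exact: measure_ge0.
- by rewrite /= lebesgue_measure_itv/=; case: ifPn.
- exact: mfin.
Qed.

Let mu_sigma_finite : sigma_finite setT mu.
Proof.
exists (@cube n.+1); first by rewrite bigcup_cube.
by move=> k; split; [exact: measurable_cube | exact: mu_cube].
Qed.

#[local] HB.instance Definition _ := @Measure_isSigmaFinite.Build _ _ _ mu
  mu_sigma_finite.

Lemma lebesgue_rV_step :
  {m' : {sigma_finite_measure set 'rV[R]_n.+1 -> \bar R} |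
    (m' : set 'rV[R]_n.+1 -> \bar R) = mu &
    forall k, (m' (@cube n.+1 k) < +oo)%E}.
Proof. by exists mu. Qed.

End step.

Let lebesgue_rV_packed n :
  {m : {sigma_finite_measure set 'rV[R]_n -> \bar R} |
    (m : set 'rV[R]_n -> \bar R) = @lebesgue_rV n &
    forall k, (m (@cube n k) < +oo)%E}.
Proof.
elim: n => [|n [m mE mfin]].
  exists \d_(0 : 'rV[R]_0) => // k /=.
  by rewrite diracE ltry.
have [m' m'E m'fin] := lebesgue_rV_step mfin.
by exists m' => //=; rewrite m'E /= mE.
Qed.

Section lebesgue_rV_instances.
Variable n : nat.

Let lebesgue_rVE :
  (sval (lebesgue_rV_packed n) : set 'rV[R]_n -> \bar R) = @lebesgue_rV n.
Proof. by case: (lebesgue_rV_packed n). Qed.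

Let lebesgue_rV0 : @lebesgue_rV n set0 = 0%E.
Proof. by rewrite -lebesgue_rVE measure0. Qed.

Let lebesgue_rV_ge0 A : (0 <= @lebesgue_rV n A)%E.
Proof. by rewrite -lebesgue_rVE measure_ge0. Qed.

Let lebesgue_rV_sigma_additive : semi_sigma_additive (@lebesgue_rV n).
Proof. rewrite -lebesgue_rVE; exact: measure_semi_sigma_additive. Qed.

HB.instance Definition _ := isMeasure.Build _ _ _ (@lebesgue_rV n)
  lebesgue_rV0 lebesgue_rV_ge0 lebesgue_rV_sigma_additive.

Let lebesgue_rV_sigma_finite : sigma_finite setT (@lebesgue_rV n).
Proof. rewrite -lebesgue_rVE; exact: sigma_finiteT. Qed.

HB.instance Definition _ := @Measure_isSigmaFinite.Build _ _ _
  (@lebesgue_rV n) lebesgue_rV_sigma_finite.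

End lebesgue_rV_instances.

Lemma lebesgue_rV_box n (A : 'I_n -> set (measurableTypeR R)) :
  (forall i, measurable (A i)) ->
  lebesgue_rV (box A) = (\prod_(i < n) lebesgue_measure (A i))%E.
Proof.
elim: n A => [|n IHn] A mA.
  rewrite big_ord0/= diracE mem_set//.
  by case.
rewrite big_ord_recl /= /pushforward preimage_cons_rV_box.
rewrite product_measure1E//; last by apply: measurable_box => i.
by rewrite -IHn.
Qed.

End lebesgue_rV.
Arguments lebesgue_rV R n : clear implicits.

Section rV_calculus.
Context {R : realType} {n : nat}.
Implicit Types (u : 'rV[R]_n -> R) (x : 'rV[R]_n).

(* Euclidean norm; the library's `|x| on 'rV[R]_n is the sup norm *)
Definition enorm x : R := Num.sqrt (\sum_i x ord0 i ^+ 2).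

Definition eball0 (r : \bar R) : set 'rV[R]_n :=
  [set x | ((enorm x)%:E < r)%E].

Definition partial (i : 'I_n) u : 'rV[R]_n -> R :=
  fun x => 'D_(delta_mx ord0 i) u x.

Definition gradient u x : 'rV[R]_n := \row_i partial i u x.

Definition laplacian u x : R := \sum_i partial i (partial i u) x.

(* C^oo: every iterated partial derivative exists and is differentiable *)
Definition smooth u : Prop :=
  forall (s : seq 'I_n) x, differentiable (foldr partial u s) x.

Definition csupport u : set 'rV[R]_n := closure [set x | u x != 0].

(* a function with compact support in the open set Omega is identified with
   its extension by 0 to R^n *)
Definition Cc_infty (Omega : set 'rV[R]_n) u : Prop :=
  [/\ smooth u, compact (csupport u) & csupport u `<=` Omega].

End rV_calculus.

Section bessel_pair.
Context {R : realType}.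
Implicit Types (r : \bar R) (V W : R -> R).

Definition itv0 r : set R := [set s | 0 < s /\ (s%:E < r)%E].

Definition smooth_on (D : set R) (f : R -> R) : Prop :=
  forall k s, D s -> derivable (f^`(k)) s 1.

(* the values of V, W and phi outside ]0, r[ are irrelevant; solutions are
   classical, the two derivatives in the equation being required to exist *)
Definition bessel_pair (n : nat) r V W : Prop :=
  (forall s, itv0 r s -> 0 <= V s) /\
  exists phi : R -> R, forall s, itv0 r s ->
    let flux t := t ^+ n.-1 * V t * (phi^`())%classic t in
    [/\ 0 < phi s, derivable phi s 1, derivable flux s 1 &
        (flux^`())%classic s + s ^+ n.-1 * W s * phi s = 0].

End bessel_pair.

(* Main.v *)
Require Import Defs.
From HB Require Import structures.
From mathcomp Require Import all_boot all_order all_algebra.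
From mathcomp Require Import all_classical all_reals all_analysis.
From mathcomp Require Import measurable_realfun ring.

Set Implicit Arguments.
Unset Strict Implicit.
Unset Printing Implicit Defensive.

Import Order.TTheory GRing.Theory Num.Theory.
Import numFieldNormedType.Exports.

Local Open Scope classical_set_scope.
Local Open Scope ring_scope.

(** Let [U] be the gradient of [u], [H] its Hessian matrix, [e = x / |x|], and
    let [T = U - (e . U) e] be the tangential part of [U]. Two integrations by
    parts turn the integral of [(Delta u)^2] into that of [|H|^2], and splitting
    [H] along [e] gives
      [|H|^2 = |H e|^2 + A + B],
    where [A] is the squared norm of the tangential part of [H e], and [B] that
    of the restriction of [H] to the hyperplane orthogonal to [e]. All the
    inequalities below hold up to the divergence of a compactly supported field.

    Radial part. If [phi] comes from an [N]-dimensional Bessel pair [(1, W)],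
    then [f = phi' / phi] solves the Riccati equation
    [f' + f^2 + (N - 1) f / r = - W] ([bessel_riccati]), and expanding
    [|H e - f U|^2 >= 0] gives [|H e|^2 >= W |U|^2]. If the pair is
    [(N + 2)]-dimensional, then [f + 1 / r] solves the [N]-dimensional Riccati
    equation of [W - (N - 1) / r^2], so that the first inequality of the theorem
    is the second one for this other potential.

    Tangential part. It remains to see that [A + B >= (N - 1) |U|^2 / |x|^2].
    Let [tau] be the trace of the restriction of [H] to the hyperplane. Then
    [tau^2 - B] is, up to a divergence,
    [(N - 2) ((N - 3) |T|^2 + (N - 1) (e . U)^2) / |x|^2],
    while [tau^2 <= (N - 1) B] ([tangential_trace_le]); hence
    [B >= ((N - 3) |T|^2 + (N - 1) (e . U)^2) / |x|^2]. This replaces a spectral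
    gap on the sphere, in the way Bochner's formula implies Lichnerowicz's
    bound. The tangential part of [H e] is the radial derivative of [T], and
    expanding the square of its sum with [T / |x|] gives the Hardy inequality
    [A >= (N - 3) |T|^2 / |x|^2]. The sum is large enough as soon as
    [2 (N - 3) >= N - 1], that is [N >= 5].

    The divergences are gathered in a single field, [rellich_field]. The proof
    is then the pointwise inequality [rellich_pointwise], and the fact that the
    divergence of a compactly supported field integrates to zero
    ([integral_div_eq0]), which follows from Fubini's theorem and the
    fundamental theorem of calculus. *)

(** * Continuous functions on row vectors: measurability and integrability *)

Section rV_norm.
Context {R : realType} {n : nat}.
Implicit Types (x y : 'rV[R]_n) (e : R).

Lemma coord_le_norm x i : `|x ord0 i| <= `|x|.
Proof.
rewrite [leRHS]/Num.Def.normr/= mx_normrE.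
exact: (le_bigmax _ (fun ij : 'I_1 * 'I_n => `|x ij.1 ij.2|) (ord0, i)).
Qed.

Lemma rV_norm_lt x e : 0 < e -> (forall i, `|x ord0 i| < e) -> `|x| < e.
Proof.
move=> e0 xe; rewrite [ltLHS]/Num.Def.normr/= mx_normrE.
by apply/bigmax_ltP; split => // -[i j] _ /=; rewrite ord1.
Qed.

Lemma rV_norm_le x e : 0 <= e -> (forall i, `|x ord0 i| <= e) -> `|x| <= e.
Proof.
move=> e0 xe; rewrite [leLHS]/Num.Def.normr/= mx_normrE.
by apply/bigmax_leP; split => // -[i j] _ /=; rewrite ord1.
Qed.

End rV_norm.

Section measurable_continuous.
Context {R : realType} {n : nat}.

Lemma measurable_rV_ball (c : 'rV[R]_n) (e : R) : 0 < e ->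
  measurable [set x : 'rV[R]_n | `|x - c| < e].
Proof.
move=> e0.
rewrite (_ : mkset _ = box (fun i => ball (c ord0 i) e)).
  by apply: measurable_box => i; by rewrite ball_itv; exact: measurable_itv.
apply/seteqP; split=> x /=.
  move=> xc i; rewrite -ball_normE /= distrC.
  by have := coord_le_norm (x - c) i; rewrite !mxE => /le_lt_trans; exact.
move=> h; apply: rV_norm_lt => // i; rewrite !mxE distrC.
by have := h i; rewrite -ball_normE.
Qed.

(** Balls with rational centre and radius form a countable base, so the
    sigma-algebra generated by the coordinates contains every open set. *)
Lemma open_measurable_rV (U : set 'rV[R]_n) : open U -> measurable U.
Proof.
move=> oU.
pose rad (k : nat) : R := k.+1%:R^-1.
pose B (p : {ffun 'I_n -> rat} * nat) : set 'rV[R]_n :=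
  [set x | `|x - \row_i ratr (p.1 i)| < rad p.2].
have -> : U = \bigcup_p (if `[< B p `<=` U >] then B p else set0).
  apply/seteqP; split=> [x Ux|x [p _]]; last first.
    by case: asboolP => // BU; exact: BU.
  have /nbhs_ballP[e /= e0 xeU] : nbhs x U by exact: open_nbhs_nbhs.
  have [k ke] : exists k, rad k < e / 2.
    have /ltr_add_invr[k] : 0 < e / 2 by rewrite divr_gt0.
    by rewrite add0r => ke; exists k.
  have rk : 0 < rad k by rewrite invr_gt0.
  have /choice[q qP] : forall i, exists q : rat, `|x ord0 i - ratr q| < rad k.
    move=> i; have /rat_in_itvoo[q] : x ord0 i - rad k < x ord0 i + rad k.
      by rewrite ltrD2l gtrN.
    by rewrite in_itv/= => qx; exists q; rewrite ltr_distlC.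
  exists ([ffun i => q i], k) => //; case: asboolP; last first.
    case=> y /=; rewrite /B/= => yq; apply: xeU.
    rewrite -ball_normE /=.
    rewrite (splitr e) -(subrK (\row_i ratr ([ffun i => q i] i)) x) -addrA.
    apply: le_lt_trans (ler_normD _ _) _; apply: ltrD.
      apply: lt_trans ke; apply: rV_norm_lt => // i.
      by rewrite !mxE ffunE.
    by apply: lt_trans ke; rewrite distrC.
  move=> _ /=; rewrite /B/=; apply: rV_norm_lt => // i.
  by rewrite !mxE ffunE.
apply: countable_bigcupT_measurable => //.
move=> p; case: asboolP => // _; apply: measurable_rV_ball.
by rewrite invr_gt0.
Qed.

Lemma continuous_measurable_rV (f : 'rV[R]_n -> R) :
  continuous f -> measurable_fun setT f.
Proof.
move=> cf; apply: (measurability (@RGenOpens.G R)).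
  exact: RGenOpens.measurableE.
move=> _ [_ [x [y ->]] <-]; rewrite setTI.
by apply: open_measurable_rV; move/continuousP : cf; apply;
  exact: interval_open.
Qed.

Lemma lebesgue_rV_cube (K : R) :
  (lebesgue_rV R n (box (fun=> `[(- K)%R, K]%classic)) < +oo)%E.
Proof.
rewrite lebesgue_rV_box; last by move=> i; exact: measurable_itv.
suff /fineK <- : (\prod_(i < n) lebesgue_measure `[(- K)%R, K]%classic)%E
    \is a fin_num by rewrite ltry.
apply: (big_ind (fun x : \bar R => x \is a fin_num)) => // [x y|i _].
  exact: fin_numM.
by rewrite lebesgue_measure_itv; case: ifP.
Qed.

(** A continuous function that vanishes far away is bounded on the cube
    containing its support, and cubes have finite measure. *)
Lemma continuous_integrable_rV (f : 'rV[R]_n -> R) (K : R) :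
  continuous f -> (forall x, K < `|x| -> f x = 0) ->
  (lebesgue_rV R n).-integrable setT (EFin \o f).
Proof.
move=> cf f0.
pose A : set 'rV[R]_n := box (fun=> `[- `|K|, `|K| ]%classic).
have mA : measurable A by apply: measurable_box => i; exact: measurable_itv.
have cA : compact A by apply: rV_compact => i; exact: segment_compact.
have -> : f = f \_ A.
  apply/funext => x; rewrite patchE; case: ifPn => //.
  rewrite notin_setE => nA; apply: f0; rewrite ltNge; apply/negP => xK.
  apply: nA => i /=; rewrite in_itv/= -ler_norml.
  apply: le_trans (coord_le_norm _ _) _; apply: le_trans xK _; exact: ler_norm.
rewrite -restrict_EFin; apply: (integrable_mkcond _ mA).1.
apply: measurable_bounded_integrable => //.
- exact: lebesgue_rV_cube.
- by apply: measurable_funTS; exact: continuous_measurable_rV.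
- have : compact (f @` A).
    apply: continuous_compact => //; exact: continuous_subspaceT.
  move/compact_bounded => [M [Mr MfA]]; exists M; split => // y My z Az.
  by apply: (MfA y My); exists z.
Qed.

End measurable_continuous.

(** * Integrals of partial derivatives *)

(** An affine map sends the difference quotients of [f \o p] to those of [f];
    this covers restrictions to a line and slices with one frozen coordinate. *)
Lemma is_derive_comp_affine (R : numFieldType) (V V' W : normedModType R)
    (p : V' -> V) (a w : V') (v : V) (f : V -> W) (d : W) :
  (forall h : R, p (h *: w + a) = h *: v + p a) ->
  is_derive (p a) v f d -> is_derive a w (f \o p) d.
Proof.
move=> pE; set q := (fun h : R => h^-1 *: ((f \o shift (p a)) (h *: v) - f (p a))).
have qE : (fun h : R => h^-1 *: ((f \o p \o shift a) (h *: w) - (f \o p) a)) = q.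
  by apply/funext => h; rewrite /q /= pE.
case=> df <-; split; first by rewrite /derivable qE.
by rewrite /derive qE.
Qed.

Section cons_rV.
Context {R : realType} {n : nat}.
Implicit Types (t h : R) (y : 'rV[R]_n).

Lemma cons_rVE0 t y : cons_rV (t, y) ord0 ord0 = t.
Proof. by rewrite mxE unlift_none. Qed.

Lemma cons_rVE t y i : cons_rV (t, y) ord0 (lift ord0 i) = y ord0 i.
Proof. by rewrite mxE liftK. Qed.

Lemma cons_rVD0 h t y :
  cons_rV (h *: 1 + t, y) = h *: delta_mx ord0 ord0 + cons_rV (t, y).
Proof.
apply/rowP => k; rewrite !mxE eqxx.
by have [j ->|->] := unliftP ord0 k;
  rewrite ?liftK ?unlift_none/= ?mulr0 ?add0r//.
Qed.

Lemma cons_rVD j h t y :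
  cons_rV (t, h *: delta_mx ord0 j + y) =
  h *: delta_mx ord0 (lift ord0 j) + cons_rV (t, y).
Proof.
apply/rowP => k; rewrite !mxE eqxx.
have [i ->|->] := unliftP ord0 k; rewrite ?liftK ?unlift_none/= ?mulr0 ?add0r//.
by rewrite !mxE eqxx (inj_eq lift_inj).
Qed.

Lemma cons_rVB t s y z : cons_rV (t, y) - cons_rV (s, z) = cons_rV (t - s, y - z).
Proof.
apply/rowP => k; rewrite !mxE.
by case: unliftP => [i|] _ /=; rewrite ?mxE.
Qed.

Lemma norm_cons_rV_lt t y e : 0 < e -> `|t| < e -> `|y| < e ->
  `|cons_rV (t, y)| < e.
Proof.
move=> e0 te ye; apply: rV_norm_lt => // i.
have [j ->|->] := unliftP ord0 i; rewrite ?cons_rVE ?cons_rVE0//.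
exact: le_lt_trans (coord_le_norm _ _) ye.
Qed.

Lemma norm_cons_rV_ge0 t y : `|t| <= `|cons_rV (t, y)|.
Proof. by rewrite -[X in `|X|](cons_rVE0 t y) coord_le_norm. Qed.

Lemma norm_cons_rV_ge t y : `|y| <= `|cons_rV (t, y)|.
Proof. by apply: rV_norm_le => // i; rewrite -(cons_rVE t) coord_le_norm. Qed.

Lemma continuous_cons_rVr t : continuous (fun y => cons_rV (t, y)).
Proof.
move=> y; apply/(@cvgrPdist_lt _ _ _ (nbhs y)) => e e0; apply/nbhs_ballP;
  exists e => // z.
by rewrite -ball_normE /= => yz; rewrite cons_rVB subrr norm_cons_rV_lt ?normr0.
Qed.

Lemma continuous_cons_rVl y : continuous (fun t => cons_rV (t, y)).
Proof.
move=> t; apply/(@cvgrPdist_lt _ _ _ (nbhs t)) => e e0; apply/nbhs_ballP;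
  exists e => // z.
by rewrite -ball_normE /= => yz; rewrite cons_rVB subrr norm_cons_rV_lt ?normr0.
Qed.

End cons_rV.

Lemma integral_derive_eq0 (R : realType) (f g : R -> R) (K : R) :
  (forall t : R, is_derive t 1 f (g t)) -> continuous g ->
  (forall t, K < `|t| -> f t = 0) -> (forall t, K < `|t| -> g t = 0) ->
  (\int[lebesgue_measure]_t (g t)%:E = 0)%E.
Proof.
move=> fg cg f0 g0; pose L := `|K| + 1.
have KL : K < L by rewrite (le_lt_trans (ler_norm _))// ltrDl.
have L0 : 0 < L by rewrite ltr_wpDl.
have cf : continuous f.
  move=> t; apply: differentiable_continuous; apply/derivable1_diffP.
  by have [] := fg t.
transitivity (\int[lebesgue_measure]_(t in `[(- L)%R, L]) (g t)%:E)%E.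
  rewrite [RHS]integral_mkcond; apply: eq_integral => t _.
  rewrite patchE; case: ifPn => //; rewrite notin_setE/= in_itv/= -ler_norml.
  by move=> /negP; rewrite -ltNge => Lt; rewrite g0// (lt_trans KL).
rewrite (continuous_FTC2 (F := f)).
- by rewrite !f0 ?subee// ?normrN gtr0_norm.
- by rewrite gtrN.
- exact: continuous_subspaceT.
- split=> [t _||].
  + by have [] := fg t.
  + exact/cvg_at_right_filter/cf.
  + exact/cvg_at_left_filter/cf.
- by move=> t _; rewrite derive1E; have [] := fg t.
Qed.

(** Fubini reduces the integral to one over the line in direction [i], where
    the fundamental theorem of calculus applies. *)
Lemma integral_partial_eq0 (R : realType) n (i : 'I_n) (f g : 'rV[R]_n -> R)
    (K : R) :
  (forall x, is_derive x (delta_mx ord0 i) f (g x)) -> continuous g ->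
  (forall x, K < `|x| -> f x = 0) -> (forall x, K < `|x| -> g x = 0) ->
  (\int[lebesgue_rV R n]_x (g x)%:E = 0)%E.
Proof.
elim: n i f g => [[]//|n IHn] i f g fg cg f0 g0.
have mg : measurable_fun setT (EFin \o g).
  by apply/measurable_EFinP; exact: continuous_measurable_rV.
have mc := @measurable_cons_rV R n.
have [_ intg] := integrableP _ _ _ (continuous_integrable_rV cg g0).
pose mu := (@lebesgue_measure R \x lebesgue_rV R n)%E.
have intgc : mu.-integrable setT (EFin \o g \o @cons_rV R n).
  apply/integrableP; split; first exact: measurableT_comp.
  apply: le_lt_trans intg.
  rewrite [leRHS](_ : _ = \int[pushforward mu (@cons_rV R n)]_x `|(EFin \o g) x|)%E//.
  rewrite ge0_integral_pushforward//.
  exact: measurableT_comp.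
rewrite [LHS](_ : _ = \int[pushforward mu (@cons_rV R n)]_x (EFin \o g) x)%E//.
rewrite integral_pushforward// preimage_setT.
have [j ij|i0] := unliftP ord0 i.
  rewrite -integral12_prod_meas1//=.
  rewrite -[RHS](integral0 lebesgue_measure setT); apply: eq_integral => t _.
  apply: (IHn j (fun y => f (cons_rV (t, y)))).
  - move=> y; apply: (@is_derive_comp_affine R _ _ _ (fun z => cons_rV (t, z)) y
      _ _ f _ _ (fg _)) => h.
    by rewrite ij cons_rVD.
  - by move=> y; apply: (@continuous_comp _ _ _ (fun z => cons_rV (t, z)) g);
      [exact: continuous_cons_rVr|exact: cg].
  - by move=> y Ky; apply: f0; exact: lt_le_trans (norm_cons_rV_ge _ _).
  - by move=> y Ky; apply: g0; exact: lt_le_trans (norm_cons_rV_ge _ _).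
rewrite -integral21_prod_meas1//=.
rewrite -[RHS](integral0 (lebesgue_rV R n) setT); apply: eq_integral => y _.
apply: (@integral_derive_eq0 _ (fun t => f (cons_rV (t, y))) _ K).
- move=> t; apply: (@is_derive_comp_affine R _ _ _ (fun s => cons_rV (s, y)) t
    _ _ f _ _ (fg _)) => h.
  by rewrite i0 cons_rVD0.
- by move=> t; apply: (@continuous_comp _ _ _ (fun s => cons_rV (s, y)) g);
    [exact: continuous_cons_rVl|exact: cg].
- by move=> t Kt; apply: f0; exact: lt_le_trans (norm_cons_rV_ge0 _ _).
- by move=> t Kt; apply: g0; exact: lt_le_trans (norm_cons_rV_ge0 _ _).
Qed.

(** * Symmetry of second derivatives *)

Section second_derivatives.
Context {R : realType} {V : normedModType R}.
Implicit Types (u uv uw uvw A B : V -> R) (x v w : V).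

Lemma is_derive_line u x v (d : R) (t : R) :
  is_derive (x + t *: v) v u d -> is_derive t 1 (fun s : R => u (x + s *: v)) d.
Proof.
apply: (@is_derive_comp_affine R _ _ _ (fun s : R => x + s *: v)) => h.
by rewrite scalerDl addrCA [_%:A]mulr1.
Qed.

(** Two applications of the mean value theorem, first in the direction [v] and
    then in the direction [w]. *)
Lemma second_difference u uv uvw x v w (h : R) : 0 < h ->
  (forall y, is_derive y v u (uv y)) -> (forall y, is_derive y w uv (uvw y)) ->
  exists c d, [/\ 0 < c < h, 0 < d < h &
    u (x + h *: v + h *: w) - u (x + h *: v) - (u (x + h *: w) - u x) =
    h ^+ 2 * uvw (x + c *: v + d *: w)].
Proof.
move=> h0 duv duvw.
have cont (f df : R -> R) : (forall t : R, is_derive t 1 f (df t)) ->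
    {within `[0, h], continuous f}.
  move=> fdf; apply: continuous_subspaceT => t.
  apply: differentiable_continuous; apply/derivable1_diffP.
  by have [] := fdf t.
pose p t := u ((x + h *: w) + t *: v) - u (x + t *: v).
pose dp t := uv ((x + h *: w) + t *: v) - uv (x + t *: v).
have pdp (t : R) : is_derive t 1 p (dp t).
  have d1 := is_derive_line (duv ((x + h *: w) + t *: v)).
  have d2 := is_derive_line (duv (x + t *: v)).
  exact: is_deriveB d1 d2.
have [c c0h pE] := MVT h0 (fun t _ => pdp t) (cont _ _ pdp).
pose q t := uv ((x + c *: v) + t *: w).
pose dq t := uvw ((x + c *: v) + t *: w).
have qdq (t : R) : is_derive t 1 q (dq t).
  exact: is_derive_line (duvw ((x + c *: v) + t *: w)).
have [d d0h qE] := MVT h0 (fun t _ => qdq t) (cont _ _ qdq).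
exists c, d; move: c0h d0h; rewrite !in_itv/= => c0h d0h; split=> //.
transitivity (p h - p 0).
  by rewrite /p !scale0r !addr0 (addrAC x (h *: v)).
rewrite pE subr0 /dp.
rewrite [X in X * h](_ : _ = q h - q 0); last first.
  by rewrite /q scale0r addr0 (addrAC x (h *: w)).
by rewrite qE subr0 /dq expr2 -mulrA mulrC.
Qed.

(** Both iterated derivatives are limits of the same second difference
    quotient. *)
Lemma mixed_derivatives_eq u uv uw A B x v w :
  (forall y, is_derive y v u (uv y)) -> (forall y, is_derive y w u (uw y)) ->
  (forall y, is_derive y w uv (A y)) -> (forall y, is_derive y v uw (B y)) ->
  {for x, continuous A} -> {for x, continuous B} -> A x = B x.
Proof.
move=> duv duw duA duB cA cB; apply/eqP; rewrite -subr_eq0 -normr_le0 leNgt.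
apply/negP => AB.
have e0 : 0 < `|A x - B x| / 2 by rewrite divr_gt0.
have near_x (C : V -> R) : {for x, continuous C} ->
    nbhs x [set y | `|C x - C y| < `|A x - B x| / 2].
  by move=> cC; exact: (@cvgr_dist_lt _ _ _ (nbhs x) _ C (C x) cC _ e0).
have /nbhs_ballP[a /= a0 aP] := near_x _ cA.
have /nbhs_ballP[b /= b0 bP] := near_x _ cB.
pose m := Num.min a b; have m0 : 0 < m by rewrite lt_min a0.
pose l := `|v| + `|w| + 1; have l0 : 0 < l by rewrite ltr_wpDl ?addr_ge0.
pose h := m / l; have h0 : 0 < h by rewrite divr_gt0.
have close (c d : R) : 0 < c < h -> 0 < d < h ->
    `|x - (x + c *: v + d *: w)| < m.
  move=> /andP[c0 ch] /andP[d0 dh].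
  rewrite -addrA opprD addNKr normrN.
  apply: le_lt_trans (ler_normD _ _) _; rewrite !normrZ !gtr0_norm//.
  apply: (@le_lt_trans _ _ (h * `|v| + h * `|w|)).
    by rewrite lerD// ler_wpM2r// ltW.
  by rewrite -mulrDr /h mulrAC ltr_pdivrMr// ltr_pM2l// ltrDl.
have [c [d [ch dh E1]]] := second_difference x h0 duv duA.
have [c' [d' [ch' dh' E2]]] := second_difference x h0 duw duB.
have E : A (x + c *: v + d *: w) = B (x + c' *: w + d' *: v).
  apply: (mulfI (lt0r_neq0 (exprn_gt0 2 h0))); rewrite -E1 -E2.
  by rewrite (addrAC x (h *: w)); ring.
have H1 : `|A x - A (x + c *: v + d *: w)| < `|A x - B x| / 2.
  apply: aP; rewrite -ball_normE /ball_; apply: lt_le_trans (close _ _ ch dh) _.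
  by rewrite ge_min lexx.
have H2 : `|B x - B (x + c' *: w + d' *: v)| < `|A x - B x| / 2.
  apply: bP; rewrite -ball_normE /ball_ addrAC.
  by apply: lt_le_trans (close _ _ dh' ch') _; rewrite ge_min lexx orbT.
rewrite -E in H2.
move: (A x) (B x) (A _) H1 H2 => a1 b1 z H1 H2.
have := ltrD H1 H2; rewrite -splitr (distrC b1).
by move=> /(le_lt_trans (ler_distD _ _ _)); rewrite ltxx.
Qed.

End second_derivatives.

(** * Rules of differentiation and functions of class C1 *)

Section derive_rules.
Context {R : realType} {V : normedModType R}.
Implicit Types (f g : V -> R) (x v : V).

Lemma is_derive_add f g x v (df dg : R) :
  is_derive x v f df -> is_derive x v g dg ->
  is_derive x v (fun y => f y + g y) (df + dg).
Proof. by move=> fx gx; exact: is_deriveD fx gx. Qed.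

Lemma is_derive_sub f g x v (df dg : R) :
  is_derive x v f df -> is_derive x v g dg ->
  is_derive x v (fun y => f y - g y) (df - dg).
Proof. by move=> fx gx; exact: is_deriveB fx gx. Qed.

Lemma is_derive_mul f g x v (df dg : R) :
  is_derive x v f df -> is_derive x v g dg ->
  is_derive x v (fun y => f y * g y) (f x * dg + g x * df).
Proof. by move=> fx gx; exact: is_deriveM fx gx. Qed.

Lemma is_derive_mull f (c : R) x v (df : R) :
  is_derive x v f df -> is_derive x v (fun y => c * f y) (c * df).
Proof. by move=> fx; exact: is_deriveZ c _ _ _ fx. Qed.

Lemma is_derive_big I (r : seq I) (F : I -> V -> R) x v (dF : I -> R) :
  (forall i, is_derive x v (F i) (dF i)) ->
  is_derive x v (fun y => \sum_(i <- r) F i y) (\sum_(i <- r) dF i).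
Proof.
move=> FdF; elim: r => [|i r IHr].
  under eq_fun do rewrite big_nil; rewrite big_nil; exact: is_derive_cst.
under eq_fun do rewrite big_cons; rewrite big_cons; exact: is_derive_add.
Qed.

Lemma is_derive_comp_real (p : R -> R) f x v (df dp : R) :
  differentiable f x -> is_derive x v f df -> is_derive (f x) 1 p dp ->
  is_derive x v (p \o f) (dp * df).
Proof.
move=> dfx [_ <-] [dpx <-].
have dp' : differentiable p (f x) by apply/derivable1_diffP.
have dpf : differentiable (p \o f) x by exact: differentiable_comp.
split; first exact: diff_derivable.
rewrite !deriveE// diff_comp//= -[X in 'd p (f x) X]mulr1.
by rewrite -[X in 'd p (f x) X]/(_ *: _) linearZ /= mulrC.
Qed.

End derive_rules.

Section C1.
Context {R : realType} {V : normedModType R}.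
Implicit Types (f g : V -> R) (D : set V) (x v : V).

(** Continuity is required of the derivative in each fixed direction, which is
    all that the integration of a divergence uses. *)
Definition C1on D f := forall x, D x ->
  differentiable f x /\ forall v, {for x, continuous ('D_v f)}.

Lemma C1on_diff D f x : C1on D f -> D x -> differentiable f x.
Proof. by move=> Df /Df[]. Qed.

Lemma C1on_derive D f x v : C1on D f -> D x -> is_derive x v f ('D_v f x).
Proof. by move=> Df /(C1on_diff Df) ?; apply/derivableP/diff_derivable. Qed.

Lemma C1on_cont D f x : C1on D f -> D x -> {for x, continuous f}.
Proof. by move=> Df /(C1on_diff Df) ?; exact: differentiable_continuous. Qed.

(** The derivative only has to be identified on the open set. *)
Lemma C1onI D f (df : V -> V -> R) : open D ->
  (forall x, D x -> differentiable f x) ->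
  (forall x v, D x -> is_derive x v f (df v x)) ->
  (forall x v, D x -> {for x, continuous (df v)}) -> C1on D f.
Proof.
move=> oD fdiff fdf cdf x Dx; split; first exact: fdiff.
move=> v; have E y : D y -> 'D_v f y = df v y by move=> /(fdf _ v)[].
rewrite /prop_for /continuous_at (E _ Dx).
apply: cvg_trans (cdf x v Dx); apply: near_eq_cvg.
apply: filterS (open_nbhs_nbhs (conj oD Dx)) => y /E; exact: esym.
Qed.

Lemma C1on_cst D (c : R) : C1on D (fun=> c).
Proof.
move=> x _; split; first exact: differentiable_cst.
move=> v; have -> : 'D_v (fun=> c) = (fun=> 0 : R).
  by apply/funext => y; rewrite derive_cst.
exact: cvg_cst.
Qed.

Variables (D : set V) (oD : open D).

Lemma C1on_add f g : C1on D f -> C1on D g -> C1on D (fun x => f x + g x).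
Proof.
move=> Cf Cg.
apply: (C1onI (df := fun v x => 'D_v f x + 'D_v g x)) => // x.
- move=> Dx; exact: differentiableD (C1on_diff Cf Dx) (C1on_diff Cg Dx).
- by move=> v Dx; apply: is_derive_add; exact: (C1on_derive _ _ Dx).
- by move=> v Dx; apply: (@cvgD _ _ _ (nbhs x));
    [apply: (Cf x Dx).2|apply: (Cg x Dx).2].
Qed.

Lemma C1on_mul f g : C1on D f -> C1on D g -> C1on D (fun x => f x * g x).
Proof.
move=> Cf Cg.
apply: (C1onI (df := fun v x => f x * 'D_v g x + g x * 'D_v f x)) => // x.
- move=> Dx; exact: differentiableM (C1on_diff Cf Dx) (C1on_diff Cg Dx).
- by move=> v Dx; apply: is_derive_mul; exact: (C1on_derive _ _ Dx).
- move=> v Dx; apply: (@cvgD _ _ _ (nbhs x)); apply: (@cvgM _ _ (nbhs x)).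
  + exact: (C1on_cont Cf Dx).
  + exact: (Cg x Dx).2.
  + exact: (C1on_cont Cg Dx).
  + exact: (Cf x Dx).2.
Qed.

Lemma C1on_mull f (c : R) : C1on D f -> C1on D (fun x => c * f x).
Proof. by move=> Cf; exact: (@C1on_mul (fun=> c) f (@C1on_cst D c) Cf). Qed.

Lemma C1on_sub f g : C1on D f -> C1on D g -> C1on D (fun x => f x - g x).
Proof.
move=> Cf Cg; under eq_fun do rewrite -mulN1r.
exact: C1on_add Cf (C1on_mull (-1) Cg).
Qed.

Lemma C1on_sum I (r : seq I) (F : I -> V -> R) :
  (forall i, C1on D (F i)) -> C1on D (fun x => \sum_(i <- r) F i x).
Proof.
move=> CF; elim: r => [|i r IHr].
  under eq_fun do rewrite big_nil; exact: C1on_cst.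
by under eq_fun do rewrite big_cons; exact: C1on_add (CF i) IHr.
Qed.

Lemma C1on_comp f (p dp : R -> R) : C1on D f ->
  (forall x, D x -> is_derive (f x) 1 p (dp (f x))) ->
  (forall x, D x -> {for f x, continuous dp}) ->
  C1on D (p \o f).
Proof.
move=> Cf pdp cdp.
apply: (C1onI (df := fun v x => dp (f x) * 'D_v f x)) => // x.
- move=> Dx; apply: differentiable_comp; first exact: (C1on_diff Cf Dx).
  by apply/derivable1_diffP; have [] := pdp x Dx.
- move=> v Dx; apply: is_derive_comp_real; first exact: (C1on_diff Cf Dx).
  + exact: (C1on_derive _ _ Dx).
  + exact: (pdp x Dx).
- move=> v Dx; apply: (@cvgM _ _ (nbhs x)); last exact: (Cf x Dx).2.
  apply: (@continuous_comp _ _ _ f dp); last exact: cdp.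
  exact: (C1on_cont Cf Dx).
Qed.

End C1.

Section rV_C1.
Context {R : realType} {n : nat}.
Implicit Types (f : 'rV[R]_n -> R) (x v : 'rV[R]_n) (D : set 'rV[R]_n).

Lemma is_derive_coord (i : 'I_n) x v :
  is_derive x v (fun y : 'rV[R]_n => y ord0 i) (v ord0 i).
Proof.
split; first by apply: diff_derivable; exact: differentiable_coord.
rewrite /derive; apply: lim_near_cst => //.
near=> h; rewrite /= !mxE addrK -[_ *: _]/(_ * _) mulKf//.
by near: h; exact: nbhs_dnbhs_neq.
Unshelve. all: by end_near. Qed.

Lemma C1on_coord D (i : 'I_n) : open D -> C1on D (fun y : 'rV[R]_n => y ord0 i).
Proof.
move=> oD; apply: (C1onI (df := fun v _ => v ord0 i)) => // x.
- by move=> _; exact: differentiable_coord.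
- by move=> v _; exact: is_derive_coord.
- by move=> v _; exact: (@cvg_cst _ _ _ (nbhs x) _).
Qed.

Lemma derive_partial f x v : differentiable f x ->
  'D_v f x = \sum_i v ord0 i * partial i f x.
Proof.
move=> df; rewrite deriveE// {1}(row_sum_delta v) linear_sum /=.
by apply: eq_bigr => i _; rewrite linearZ /= /partial deriveE.
Qed.

Lemma smooth_partial f (i : 'I_n) : smooth f -> smooth (partial i f).
Proof. by move=> sf s x; have := sf (rcons s i) x; rewrite foldr_rcons. Qed.

Lemma smooth_diff f x : smooth f -> differentiable f x.
Proof. by move=> sf; exact: (sf [::]). Qed.

Lemma C1on_smooth D f : smooth f -> C1on D f.
Proof.
move=> sf x _; split; first exact: smooth_diff.
move=> v; apply: differentiable_continuous.
rewrite (_ : 'D_v f = \sum_i (v ord0 i \*: partial i f)).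
  apply: differentiable_sum => i; apply: differentiableZ.
  exact: (smooth_diff _ (smooth_partial i sf)).
apply/funext => y; rewrite derive_partial; last exact: smooth_diff.
by rewrite fct_sumE.
Qed.

Lemma partialC f (i j : 'I_n) : smooth f ->
  partial i (partial j f) = partial j (partial i f).
Proof.
move=> sf; apply/funext => x.
have dp (g : 'rV[R]_n -> R) (k : 'I_n) (y : 'rV[R]_n) : smooth g ->
    is_derive y (delta_mx ord0 k) g (partial k g y).
  move=> sg; apply: derivableP; apply: diff_derivable;
    exact: (smooth_diff y sg).
have cp (g : 'rV[R]_n -> R) (k : 'I_n) : smooth g -> {for x, continuous (partial k g)}.
  move=> sg; apply: differentiable_continuous.
  exact: (smooth_diff _ (smooth_partial k sg)).
apply: (@mixed_derivatives_eq _ _ f (partial j f) (partial i f)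
  (partial i (partial j f)) (partial j (partial i f)) x
  (delta_mx ord0 j) (delta_mx ord0 i)) => [y|y|y|y||].
- exact: dp sf.
- exact: dp sf.
- exact: dp (smooth_partial j sf).
- exact: dp (smooth_partial i sf).
- exact: cp (smooth_partial j sf).
- exact: cp (smooth_partial i sf).
Qed.

End rV_C1.

Section inverse.
Context {R : realType} {V : normedModType R}.
Implicit Types (f : V -> R) (x v : V).

Lemma is_derive_inv f x v (df : R) : f x != 0 -> is_derive x v f df ->
  is_derive x v (fun y => (f y)^-1) (- (f x) ^- 2 * df).
Proof.
move=> fx0 [dfx <-]; split; first exact: derivableV.
by rewrite deriveV.
Qed.

Lemma C1on_inv (D : set V) f : open D -> (forall x, D x -> f x != 0) ->
  C1on D f -> C1on D (fun x => (f x)^-1).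
Proof.
move=> oD f0 Cf.
apply: (C1onI (df := fun v x => - (f x) ^- 2 * 'D_v f x) oD) => x.
- by move=> Dx; apply: differentiableV (f0 _ Dx); exact: (C1on_diff Cf Dx).
- by move=> v Dx; apply: is_derive_inv (f0 _ Dx) _;
    exact: (C1on_derive _ Cf Dx).
- move=> v Dx; apply: (@cvgM _ _ (nbhs x)); last exact: (Cf x Dx).2.
  apply: cvgN; apply: cvgV; first by rewrite expf_neq0// f0.
  by apply: cvgM; exact: (C1on_cont Cf Dx).
Qed.

End inverse.

(** * Algebra of the pointwise inequality *)

Section pointwise.
Context {R : realType} {n : nat}.
Implicit Types (x U h k : 'I_n -> R) (H : 'I_n -> 'I_n -> R).

Lemma sum_sqr_subZ h U (a : R) :
  \sum_i (h i - a * U i) ^+ 2 =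
  \sum_i h i * h i + (- 2 * a) * (\sum_i U i * h i) +
  a ^+ 2 * (\sum_i U i * U i).
Proof.
rewrite !mulr_sumr -!big_split; apply: eq_bigr => i _ /=; ring.
Qed.

Lemma sum_sqr_addBZ h U x (a : R) :
  \sum_i (h i + U i - a * x i) ^+ 2 =
  \sum_i h i * h i + 2 * (\sum_i U i * h i) + \sum_i U i * U i +
  (- 2 * a) * (\sum_i x i * h i) + (- 2 * a) * (\sum_i x i * U i) +
  a ^+ 2 * (\sum_i x i * x i).
Proof.
rewrite !mulr_sumr -!big_split; apply: eq_bigr => i _ /=; ring.
Qed.

Lemma sum_delta (i : 'I_n) (f : 'I_n -> R) : \sum_j (i == j)%:R * f j = f i.
Proof.
rewrite (bigD1 i)//= eqxx mul1r big1 ?addr0// => j ji.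
by rewrite eq_sym (negbTE ji) mul0r.
Qed.

Lemma sum_sum_mul (a b : 'I_n -> R) :
  \sum_i \sum_j a i * b j = (\sum_i a i) * (\sum_i b i).
Proof. by rewrite big_distrlr. Qed.

(** For suitable [g], [k] and [c], the matrix on the left is the traceless part
    of the restriction of [H] to the hyperplane orthogonal to [x]. *)
Lemma sum_sqr_mx H x h k (g c : R) :
  (forall i j, H i j = H j i) ->
  (forall i, h i = \sum_j H i j * x j) ->
  \sum_i \sum_j
    (H i j - g * (x i * k j + k i * x j) - c * (i == j)%:R) ^+ 2 =
  \sum_i \sum_j H i j ^+ 2 +
  2 * g ^+ 2 * ((\sum_i x i * x i) * (\sum_i k i * k i) +
                (\sum_i x i * k i) ^+ 2) +
  n%:R * c ^+ 2 - 4 * g * (\sum_i k i * h i) - 2 * c * (\sum_i H i i) +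
  4 * c * g * (\sum_i x i * k i).
Proof.
move=> Hsym hE.
have kh : \sum_i k i * h i = \sum_i \sum_j k i * (H i j * x j).
  by apply: eq_bigr => i _; rewrite hE mulr_sumr.
have kh' : \sum_i k i * h i = \sum_i \sum_j x i * (H i j * k j).
  rewrite kh exchange_big; apply: eq_bigr => i _; apply: eq_bigr => j _ /=.
  rewrite Hsym; ring.
have -> : 2 * g ^+ 2 * ((\sum_i x i * x i) * (\sum_i k i * k i) +
                (\sum_i x i * k i) ^+ 2) =
    g ^+ 2 * (\sum_i \sum_j (x i * x i) * (k j * k j)) +
    g ^+ 2 * (\sum_i \sum_j (k i * k i) * (x j * x j)) +
    2 * g ^+ 2 * (\sum_i \sum_j (x i * k i) * (x j * k j)).
  rewrite !sum_sum_mul; ring.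
have -> : n%:R * c ^+ 2 = c ^+ 2 * \sum_(i < n) \sum_(j < n) (i == j)%:R * 1.
  under eq_bigr do rewrite sum_delta.
  by rewrite sumr_const card_ord mulrC.
have -> : 4 * g * (\sum_i k i * h i) =
    2 * g * (\sum_i \sum_j k i * (H i j * x j)) +
    2 * g * (\sum_i \sum_j x i * (H i j * k j)).
  by rewrite -kh -kh'; ring.
have -> : \sum_i H i i = \sum_i \sum_j (i == j)%:R * H i j.
  by apply: eq_bigr => i _; rewrite sum_delta.
have -> : 4 * c * g * (\sum_i x i * k i) =
    4 * c * g * (\sum_i \sum_j (i == j)%:R * (x i * k j)).
  by congr (_ * _); apply: eq_bigr => i _; rewrite sum_delta.
rewrite opprD -!mulNr !mulr_sumr -!big_split; apply: eq_bigr => i _ /=.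
rewrite !mulr_sumr -!big_split; apply: eq_bigr => j _ /=.
have [->|ij] := eqVneq i j; rewrite /=; ring.
Qed.

(** The restriction of [H] to the hyperplane orthogonal to [x] is an
    [n - 1] square matrix, and the square of its trace is at most [n - 1]
    times its squared norm: subtract the multiple [c] of the identity of that
    hyperplane that makes it traceless. *)
Lemma tangential_trace_le H x h (g : R) : (1 < n)%N ->
  (forall i j, H i j = H j i) ->
  (forall i, h i = \sum_j H i j * x j) ->
  g * (\sum_i x i * x i) = 1 ->
  forall b, b = \sum_i x i * h i ->
  (\sum_i H i i - g * b) ^+ 2 <=
  (n%:R - 1) * (\sum_i \sum_j H i j ^+ 2 - 2 * g * (\sum_i h i * h i) +
                g ^+ 2 * b ^+ 2).
Proof.
move=> n1 Hsym hE gx b bE.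
set D := \sum_i H i i; set hh := \sum_i h i * h i.
set Q := \sum_i \sum_j _.
have n1' : (0 : R) < n%:R - 1 by rewrite subr_gt0 ltr1n.
pose c := (D - g * b) / (n%:R - 1).
(* [k] must account for the radial row and column of [H], for their common
   entry counted twice, and for the multiple [c * g] of [x x^T] by which the
   projector onto the hyperplane differs from the identity. *)
pose e := g * b + c.
pose k i := h i - e / 2 * x i.
have kk : \sum_i k i * k i = hh + (- e) * b + e ^+ 2 / 4 * (\sum_i x i * x i).
  rewrite /hh bE !mulr_sumr -!big_split; apply: eq_bigr => i _ /=.
  by rewrite /k; field.
have xk : \sum_i x i * k i = b + (- (e / 2)) * (\sum_i x i * x i).
  rewrite bE !mulr_sumr -!big_split; apply: eq_bigr => i _ /=.
  by rewrite /k; ring.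
have kh : \sum_i k i * h i = hh + (- (e / 2)) * b.
  rewrite /hh bE !mulr_sumr -!big_split; apply: eq_bigr => i _ /=.
  by rewrite /k; ring.
have := sum_sqr_mx k g c Hsym hE; rewrite kk xk kh -/D -/Q.
set r := \sum_i x i * x i in gx *.
set S := \sum_i \sum_j _; have S0 : 0 <= S.
  by apply: sumr_ge0 => i _; apply: sumr_ge0 => j _; exact: sqr_ge0.
move=> SE.
have {SE} : S = Q - 2 * g * hh + g ^+ 2 * b ^+ 2 - (D - g * b) ^+ 2 / (n%:R - 1).
  have cE : D = c * (n%:R - 1) + g * b by rewrite /c divfK ?subrK// gt_eqF.
  have -> : (D - g * b) ^+ 2 / (n%:R - 1) = c ^+ 2 * (n%:R - 1).
    by rewrite cE addrK; field; rewrite gt_eqF.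
  have g0 : g != 0 by apply: contra_eq_neq gx => ->;
    rewrite mul0r eq_sym oner_neq0.
  have rE : r = g^-1 by apply: (mulfI g0); rewrite gx divff.
  by rewrite SE rE cE /e; field.
move=> SE; move: S0; rewrite SE subr_ge0 ler_pdivrMr// => /le_trans; apply.
by rewrite mulrC.
Qed.

End pointwise.

(** The first summand on the right is the divergence of [rellich_field] at a
    point, with [r2 = |x|^2], [g = 1 / r2], [D] the Laplacian, [Q = |H|^2],
    [hh = |H x|^2], [b = x . H x], [s = x . U], [q = |U|^2] and [uh = U . H x];
    [p] is the derivative of [psi = f / r] along [x], as the Riccati equation
    of [f] gives it. The next three summands are the deficits of the radial
    inequality, of Hardy's inequality and of the trace inequality; the last one
    is the excess of the constant obtained over [n - 1]. *)
Lemma rellich_scalar_identity (R : realFieldType)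
    (n r2 g D Q hh b s q uh psi p W kappa theta : R) :
  n - 2 != 0 -> p = - W - n * psi - r2 * psi ^+ 2 ->
  let m := n - 2 in
  let t := q - g * s ^+ 2 in
  D ^+ 2 - (W + (n - 1) * g) * q =
  (((1 + m^-1) * D - 2 / m * (g * b)) * D +
   ((1 + m^-1) * kappa - 2 / m * (g * (2 * uh + theta) - 2 * g ^+ 2 * s * b)) -
   (1 + m^-1) * (kappa + Q) +
   (n * (psi * q - (1 - 2 / m) * (g * t) - (n - 1) / m * (g * q) +
         2 / m * (g * uh)) +
    (psi * (2 * uh) + q * p -
     (1 - 2 / m) * (g * (2 * uh - 2 * g * s * b) - 2 * g * t) -
     (n - 1) / m * (g * (2 * uh) - 2 * g * q) +
     2 / m * (g * (hh + uh + theta) - 2 * g * uh)))) +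
  (g * hh - 2 * psi * uh + r2 * psi ^+ 2 * q) +
  g * (hh + 2 * uh + q - g * (b + s) ^+ 2) +
  ((n - 1) * (Q - 2 * g * hh + g ^+ 2 * b ^+ 2) - (D - g * b) ^+ 2) / m +
  (n - 5) * (g * t).
Proof. by move=> m0 -> /=; field. Qed.

(** * Contractions of the gradient and the Hessian with the position *)

Section fields.
Context {R : realType} {n : nat}.
Implicit Types (x y v : 'rV[R]_n).
Variable u : 'rV[R]_n -> R.

Definition hess (i j : 'I_n) : 'rV[R]_n -> R := partial i (partial j u).
Definition rsq y := \sum_i y ord0 i * y ord0 i.
Definition xgrad y := \sum_i y ord0 i * partial i u y.
Definition grad_sq y := \sum_i partial i u y * partial i u y.
Definition hess_x (i : 'I_n) y := \sum_j hess i j y * y ord0 j.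
Definition hess_grad (i : 'I_n) y := \sum_j hess i j y * partial j u y.
Definition hess_xx y := \sum_i y ord0 i * hess_x i y.
Definition hess_xgrad y := \sum_i partial i u y * hess_x i y.

Hypothesis su : smooth u.

Lemma smooth_hess i j : smooth (hess i j).
Proof. exact: smooth_partial (smooth_partial j su). Qed.

Lemma hessC i j : hess i j = hess j i.
Proof. exact: partialC. Qed.

Lemma is_derive_smooth (f : 'rV[R]_n -> R) x v : smooth f ->
  is_derive x v f ('D_v f x).
Proof. by move=> sf; apply: derivableP; apply: diff_derivable;
  exact: smooth_diff. Qed.

Lemma is_derive_partial (f : 'rV[R]_n -> R) i x d :
  is_derive x (delta_mx ord0 i) f d -> partial i f x = d.
Proof. by case. Qed.

Lemma derive_partial_grad j x v :
  'D_v (partial j u) x = \sum_k hess j k x * v ord0 k.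
Proof.
rewrite derive_partial; last exact: smooth_diff _ (smooth_partial j su).
by apply: eq_bigr => k _; rewrite mulrC -/(hess k j) hessC.
Qed.

Lemma is_derive_grad j x v :
  is_derive x v (partial j u) (\sum_k hess j k x * v ord0 k).
Proof.
rewrite -derive_partial_grad; apply: is_derive_smooth; exact: smooth_partial.
Qed.

Lemma is_derive_rsq x v :
  is_derive x v rsq (2 * \sum_i x ord0 i * v ord0 i).
Proof.
rewrite mulr_sumr; apply: is_derive_big => i.
apply: is_derive_eq (is_derive_mul (is_derive_coord i x v) (is_derive_coord i x v)) _.
ring.
Qed.

Lemma is_derive_xgrad x v : is_derive x v xgrad
  (\sum_i (x ord0 i * (\sum_k hess i k x * v ord0 k) + partial i u x * v ord0 i)).
Proof.
apply: is_derive_big => i.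
exact: is_derive_mul (is_derive_coord i x v) (is_derive_grad i x v).
Qed.

Lemma is_derive_grad_sq x v : is_derive x v grad_sq
  (2 * \sum_i partial i u x * (\sum_k hess i k x * v ord0 k)).
Proof.
rewrite mulr_sumr; apply: is_derive_big => i.
apply: is_derive_eq (is_derive_mul (is_derive_grad i x v) (is_derive_grad i x v)) _.
ring.
Qed.

Lemma is_derive_hess_x i x v : is_derive x v (hess_x i)
  (\sum_j (hess i j x * v ord0 j + x ord0 j * 'D_v (hess i j) x)).
Proof.
apply: is_derive_big => j.
exact: is_derive_mul (is_derive_smooth x v (smooth_hess i j)) (is_derive_coord j x v).
Qed.

Lemma is_derive_hess_grad i x v : is_derive x v (hess_grad i)
  (\sum_j (hess i j x * (\sum_k hess j k x * v ord0 k) +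
           partial j u x * 'D_v (hess i j) x)).
Proof.
apply: is_derive_big => j.
exact: is_derive_mul (is_derive_smooth x v (smooth_hess i j)) (is_derive_grad j x v).
Qed.

Lemma is_derive_hess_xx x v : is_derive x v hess_xx
  (\sum_i (x ord0 i * (\sum_j (hess i j x * v ord0 j + x ord0 j * 'D_v (hess i j) x))
   + hess_x i x * v ord0 i)).
Proof.
apply: is_derive_big => i.
exact: is_derive_mul (is_derive_coord i x v) (is_derive_hess_x i x v).
Qed.

Lemma is_derive_hess_xgrad x v : is_derive x v hess_xgrad
  (\sum_i (partial i u x *
           (\sum_j (hess i j x * v ord0 j + x ord0 j * 'D_v (hess i j) x))
   + hess_x i x * (\sum_k hess i k x * v ord0 k))).
Proof.
apply: is_derive_big => i.
exact: is_derive_mul (is_derive_grad i x v) (is_derive_hess_x i x v).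
Qed.

Lemma is_derive_laplacian x v : is_derive x v (laplacian u)
  (\sum_i 'D_v (hess i i) x).
Proof. by apply: is_derive_big => i; exact: is_derive_smooth (smooth_hess i i). Qed.

(** The third derivatives of [u] enter the computation only through the
    contractions [theta] and [kappa], which cancel in the divergence of
    [rellich_field]. *)
Definition theta x :=
  \sum_i \sum_j \sum_k partial i u x * x ord0 j * x ord0 k *
    partial i (hess j k) x.

Definition kappa x := 'D_(gradient u x) (laplacian u) x.

Lemma derive_hess v i j x :
  'D_v (hess i j) x = \sum_k v ord0 k * partial k (hess i j) x.
Proof. by rewrite derive_partial//; exact: smooth_diff (smooth_hess i j). Qed.

Lemma partial_hessC i j k : partial i (hess j k) = partial j (hess i k).
Proof. by rewrite /hess (partialC i j (smooth_partial k su)). Qed.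

Lemma thetaE1 x : \sum_i x ord0 i *
  (\sum_j x ord0 j * 'D_(gradient u x) (hess i j) x) = theta x.
Proof.
rewrite /theta [RHS]exchange_big; apply: eq_bigr => j _ /=.
rewrite [RHS]exchange_big /= mulr_sumr; apply: eq_bigr => k _ /=.
rewrite derive_hess !mulr_sumr; apply: eq_bigr => i _.
by rewrite mxE; ring.
Qed.

Lemma thetaE2 x : \sum_i partial i u x *
  (\sum_j x ord0 j * 'D_x (hess i j) x) = theta x.
Proof.
apply: eq_bigr => i _; rewrite mulr_sumr [RHS]exchange_big.
apply: eq_bigr => j _ /=; rewrite derive_hess !mulr_sumr; apply: eq_bigr => k _.
by rewrite partial_hessC; ring.
Qed.

Lemma derive_x_grad_sq x : is_derive x x grad_sq (2 * hess_xgrad x).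
Proof. exact: is_derive_grad_sq. Qed.

Lemma derive_x_xgrad x : is_derive x x xgrad (hess_xx x + xgrad x).
Proof.
apply: is_derive_eq (is_derive_xgrad x x) _.
rewrite big_split /=; congr (_ + _).
by apply: eq_bigr => i _; rewrite mulrC.
Qed.

Lemma derive_x_rsq x : is_derive x x rsq (2 * rsq x).
Proof. exact: is_derive_rsq. Qed.

Lemma derive_x_hess_xgrad x : is_derive x x hess_xgrad
  (hess_xgrad x + theta x + \sum_i hess_x i x * hess_x i x).
Proof.
apply: is_derive_eq (is_derive_hess_xgrad x x) _.
rewrite big_split /=; congr (_ + _).
rewrite -thetaE2 -big_split /=; apply: eq_bigr => i _.
by rewrite big_split mulrDr.
Qed.

Lemma derive_grad_rsq x : is_derive x (gradient u x) rsq (2 * xgrad x).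
Proof.
apply: is_derive_eq (is_derive_rsq _ _) _; congr (_ * _).
by apply: eq_bigr => i _; rewrite mxE.
Qed.

Lemma sum_x_hess_grad x : \sum_i x ord0 i * hess_grad i x = hess_xgrad x.
Proof.
rewrite /hess_xgrad; under eq_bigr do rewrite mulr_sumr.
under [RHS]eq_bigr do rewrite mulr_sumr.
rewrite exchange_big; apply: eq_bigr => i _; apply: eq_bigr => j _ /=.
by rewrite hessC; ring.
Qed.

Lemma derive_grad_hess_xx x : is_derive x (gradient u x) hess_xx
  (2 * hess_xgrad x + theta x).
Proof.
apply: is_derive_eq (is_derive_hess_xx _ _) _.
rewrite big_split /=.
have -> : \sum_i hess_x i x * gradient u x ord0 i = hess_xgrad x.
  by apply: eq_bigr => i _; rewrite mxE mulrC.
under eq_bigr do rewrite big_split mulrDr.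
rewrite big_split /= thetaE1.
rewrite [X in X + _ + _](_ : _ = hess_xgrad x); first by ring.
rewrite -sum_x_hess_grad; apply: eq_bigr => i _; congr (_ * _).
by apply: eq_bigr => j _; rewrite mxE.
Qed.

Lemma div_hess_grad x :
  \sum_i partial i (hess_grad i) x =
  kappa x + \sum_i \sum_j hess i j x ^+ 2.
Proof.
have -> : kappa x = \sum_i \sum_j partial j u x * partial j (hess i i) x.
  rewrite /kappa; have [_ ->] := is_derive_laplacian x (gradient u x).
  apply: eq_bigr => i _; rewrite derive_hess; apply: eq_bigr => j _.
  by rewrite mxE.
rewrite -big_split /=; apply: eq_bigr => i _; rewrite -big_split /=.
rewrite (is_derive_partial (is_derive_hess_grad i x (delta_mx ord0 i))).
apply: eq_bigr => j _.
have -> : \sum_k hess j k x * (delta_mx ord0 i : 'rV[R]_n) ord0 k = hess i j x.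
  under eq_bigr do rewrite mxE eqxx /= eq_sym mulrC.
  by rewrite sum_delta hessC.
have E : partial i (hess i j) x = partial j (hess i i) x.
  by rewrite (hessC i j); exact: (congr1 (fun f => f x) (partial_hessC i j i)).
have aux (a b c d : R) : c = d -> a * a + b * c = b * d + a ^+ 2.
  by move=> ->; rewrite addrC.
exact: (aux _ _ _ _ E).
Qed.

End fields.

(** * The vector field and its divergence *)

Lemma sum_div_split (R : realType) n (A B C : R) (a b c d e f : 'I_n -> R) :
  \sum_i (A * a i + b i * c i - B * d i + (C + e i * f i)) =
  A * (\sum_i a i) + \sum_i b i * c i - B * (\sum_i d i) +
  (n%:R * C + \sum_i e i * f i).
Proof.
rewrite !big_split /= sumrN -!mulr_sumr sumr_const card_ord.
by rewrite -[C *+ n]mulr_natl.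
Qed.

Section vector_field.
Context {R : realType} {n : nat}.
Variables (u psi : 'rV[R]_n -> R) (D : set 'rV[R]_n).
Implicit Types (x y v : 'rV[R]_n).
Hypotheses (oD : open D) (su : smooth u) (Cpsi : C1on D psi).
Hypothesis rsq0 : forall x, D x -> rsq x != 0.

Let m : R := n%:R - 2.

(** The squared norm [|T|^2] of the tangential part of the gradient. *)
Definition tang_sq y := grad_sq u y - (rsq y)^-1 * (xgrad u y * xgrad u y).

Definition coef_grad y :=
  (1 + m^-1) * laplacian u y - 2 / m * ((rsq y)^-1 * hess_xx u y).

Definition coef_x y :=
  psi y * grad_sq u y - (1 - 2 / m) * ((rsq y)^-1 * tang_sq y) -
  (n%:R - 1) / m * ((rsq y)^-1 * grad_sq u y) +
  2 / m * ((rsq y)^-1 * hess_xgrad u y).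

(** With [Y = ((x . H x) U - (U . H x) x) / |x|^2], this is the field
      [(1 + 1 / m) ((Delta u) U - H U) - (2 / m) Y + c x],
    where [c = psi |U|^2 - (1 - 2 / m) |T|^2 / |x|^2
               - ((n - 1) / m) |U|^2 / |x|^2].
    The divergence of [(Delta u) U - H U] is [(Delta u)^2 - |H|^2], and that of
    [Y] is the similar quadratic form [(Delta u) H_ee - |H e|^2] plus radial
    derivatives of [|U|^2] and [|T|^2], which the terms of [c] in [1 / m] and
    [2 / m] turn into multiples of [|U|^2] and [|T|^2]. The term in [psi] does
    the same for the radial inequality, and [- |T|^2 / |x|^2] for Hardy's. The
    weight [1 / m] comes from [m B >= tau^2 - B], with [m = n - 2]. *)
Definition rellich_field (i : 'I_n) y :=
  coef_grad y * partial i u y - (1 + m^-1) * hess_grad u i y + coef_x y * y ord0 i.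

Let Ccoord i : C1on D (fun y : 'rV[R]_n => y ord0 i).
Proof. exact: C1on_coord. Qed.

Let Cpartial i : C1on D (partial i u).
Proof. exact: C1on_smooth (smooth_partial i su). Qed.

Let Chess i j : C1on D (hess u i j).
Proof. exact: C1on_smooth (smooth_hess su i j). Qed.

Let Crsq : C1on D (@rsq R n).
Proof. by apply: (C1on_sum oD) => i; exact: (C1on_mul oD (Ccoord i) (Ccoord i)). Qed.

Let Cinv : C1on D (fun y => (rsq y)^-1).
Proof. exact: C1on_inv. Qed.

Let Cxgrad : C1on D (xgrad u).
Proof. by apply: (C1on_sum oD) => i; exact: (C1on_mul oD (Ccoord i) (Cpartial i)). Qed.

Let Cgrad_sq : C1on D (grad_sq u).
Proof. by apply: (C1on_sum oD) => i; exact: (C1on_mul oD (Cpartial i) (Cpartial i)). Qed.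

Let Chess_x i : C1on D (hess_x u i).
Proof. by apply: (C1on_sum oD) => j; exact: (C1on_mul oD (Chess i j) (Ccoord j)). Qed.

Let Chess_grad i : C1on D (hess_grad u i).
Proof. by apply: (C1on_sum oD) => j; exact: (C1on_mul oD (Chess i j) (Cpartial j)). Qed.

Let Chess_xx : C1on D (hess_xx u).
Proof. by apply: (C1on_sum oD) => i; exact: (C1on_mul oD (Ccoord i) (Chess_x i)). Qed.

Let Chess_xgrad : C1on D (hess_xgrad u).
Proof. by apply: (C1on_sum oD) => i; exact: (C1on_mul oD (Cpartial i) (Chess_x i)). Qed.

Let Clapl : C1on D (laplacian u).
Proof. by apply: (C1on_sum oD) => i; exact: (Chess i i). Qed.

Let Ctang : C1on D tang_sq.
Proof. exact: (C1on_sub oD Cgrad_sq (C1on_mul oD Cinv (C1on_mul oD Cxgrad Cxgrad))). Qed.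

Let Ccoef_grad : C1on D coef_grad.
Proof.
exact: (C1on_sub oD (C1on_mull oD _ Clapl) (C1on_mull oD _ (C1on_mul oD Cinv Chess_xx))).
Qed.

Let Ccoef_x : C1on D coef_x.
Proof.
apply: (C1on_add oD); last exact: (C1on_mull oD _ (C1on_mul oD Cinv Chess_xgrad)).
apply: (C1on_sub oD); last exact: (C1on_mull oD _ (C1on_mul oD Cinv Cgrad_sq)).
apply: (C1on_sub oD); last exact: (C1on_mull oD _ (C1on_mul oD Cinv Ctang)).
exact: (C1on_mul oD Cpsi Cgrad_sq).
Qed.

Lemma C1on_rellich_field i : C1on D (rellich_field i).
Proof.
apply: (C1on_add oD); last exact: (C1on_mul oD Ccoef_x (Ccoord i)).
apply: (C1on_sub oD); last exact: (C1on_mull oD _ (Chess_grad i)).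
exact: (C1on_mul oD Ccoef_grad (Cpartial i)).
Qed.

Lemma div_rellich_field x : D x ->
  \sum_i partial i (rellich_field i) x =
  coef_grad x * laplacian u x + 'D_(gradient u x) coef_grad x -
  (1 + m^-1) * (kappa u x + \sum_i \sum_j hess u i j x ^+ 2) +
  (n%:R * coef_x x + 'D_x coef_x x).
Proof.
move=> Dx.
have E i : partial i (rellich_field i) x =
    coef_grad x * partial i (partial i u) x +
    gradient u x ord0 i * partial i coef_grad x -
    (1 + m^-1) * partial i (hess_grad u i) x +
    (coef_x x + x ord0 i * partial i coef_x x).
  apply: is_derive_partial; apply: is_derive_add.
    apply: is_derive_sub.
      rewrite mxE; apply: is_derive_mul.
        exact: (C1on_derive _ Ccoef_grad Dx).
      exact: (C1on_derive _ (Cpartial i) Dx).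
    apply: is_derive_mull; exact: (C1on_derive _ (Chess_grad i) Dx).
  apply: is_derive_eq.
    apply: is_derive_mul (is_derive_coord i x _).
    exact: (C1on_derive _ Ccoef_x Dx).
  by rewrite mxE !eqxx mulr1.
apply: etrans (eq_bigr _ (fun i _ => E i)) _.
apply: etrans (sum_div_split _ _ _ _ _ _ _ _ _) _.
by rewrite (div_hess_grad su) (derive_partial _ (C1on_diff Ccoef_grad Dx))
  (derive_partial _ (C1on_diff Ccoef_x Dx)).
Qed.

End vector_field.

Section divergence_value.
Context {R : realType} {n : nat}.
Variables (u psi : 'rV[R]_n -> R) (p : R).
Implicit Types (x y v : 'rV[R]_n).
Hypothesis su : smooth u.

Let m : R := n%:R - 2.

Lemma derive_grad_coef_grad x : rsq x != 0 ->
  is_derive x (gradient u x) (coef_grad u)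
    ((1 + m^-1) * kappa u x -
     2 / m * ((rsq x)^-1 * (2 * hess_xgrad u x + theta u x) -
              2 * (rsq x)^-1 ^+ 2 * xgrad u x * hess_xx u x)).
Proof.
move=> r0; apply: is_derive_sub.
  apply: is_derive_mull; apply: derivableP.
  by have [] := is_derive_laplacian su x (gradient u x).
apply: is_derive_mull.
apply: is_derive_eq.
  exact: is_derive_mul (is_derive_inv r0 (derive_grad_rsq u x))
    (derive_grad_hess_xx su x).
by cbv beta; field.
Qed.

Lemma derive_x_inv_rsq x : rsq x != 0 ->
  is_derive x x (fun y => (rsq y)^-1) (- 2 * (rsq x)^-1).
Proof.
move=> r0; apply: is_derive_eq (is_derive_inv r0 (derive_x_rsq x)) _.
by cbv beta; field.
Qed.

Lemma derive_x_tang_sq x : rsq x != 0 -> is_derive x x (tang_sq u)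
  (2 * hess_xgrad u x - 2 * (rsq x)^-1 * xgrad u x * hess_xx u x).
Proof.
move=> r0; apply: is_derive_eq.
  apply: is_derive_sub (derive_x_grad_sq su x) _.
  apply: is_derive_mul (derive_x_inv_rsq r0) _.
  exact: is_derive_mul (derive_x_xgrad su x) (derive_x_xgrad su x).
by cbv beta; ring.
Qed.

Lemma derive_x_coef_x x : rsq x != 0 -> is_derive x x psi p ->
  is_derive x x (coef_x u psi)
  (psi x * (2 * hess_xgrad u x) + grad_sq u x * p -
   (1 - 2 / m) * ((rsq x)^-1 * (2 * hess_xgrad u x -
                     2 * (rsq x)^-1 * xgrad u x * hess_xx u x) -
                  2 * (rsq x)^-1 * tang_sq u x) -
   (n%:R - 1) / m * ((rsq x)^-1 * (2 * hess_xgrad u x) -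
                     2 * (rsq x)^-1 * grad_sq u x) +
   2 / m * ((rsq x)^-1 * (\sum_i hess_x u i x * hess_x u i x +
               hess_xgrad u x + theta u x) -
            2 * (rsq x)^-1 * hess_xgrad u x)).
Proof.
move=> r0 dpsi; apply: is_derive_add; last first.
  apply: is_derive_mull; apply: is_derive_eq.
    exact: is_derive_mul (derive_x_inv_rsq r0) (derive_x_hess_xgrad su x).
  by cbv beta; ring.
apply: is_derive_sub; last first.
  apply: is_derive_mull; apply: is_derive_eq.
    exact: is_derive_mul (derive_x_inv_rsq r0) (derive_x_grad_sq su x).
  by cbv beta; ring.
apply: is_derive_sub.
  exact: is_derive_mul dpsi (derive_x_grad_sq su x).
apply: is_derive_mull; apply: is_derive_eq.
  exact: is_derive_mul (derive_x_inv_rsq r0) (derive_x_tang_sq r0).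
by cbv beta; ring.
Qed.

End divergence_value.

(** * The pointwise inequality *)

Lemma sumr_sqr_ge0 (R : realDomainType) n (f : 'I_n -> R) :
  0 <= \sum_i f i ^+ 2.
Proof. by apply: sumr_ge0 => i _; exact: sqr_ge0. Qed.

Section pointwise_rellich.
Context {R : realType} {n : nat}.
Variables (u psi p W : 'rV[R]_n -> R) (D : set 'rV[R]_n).
Hypotheses (n5 : (5 <= n)%N) (oD : open D) (su : smooth u) (Cpsi : C1on D psi).
Hypothesis dpsi : forall x, D x -> is_derive x x psi (p x).
Hypothesis rsq0 : forall x, D x -> rsq x != 0.
Hypothesis riccati : forall x, D x ->
  p x = - W x - n%:R * psi x - rsq x * psi x ^+ 2.

(** The difference of the two sides is a sum of squares and of a multiple
    [n - 5] of [|T|^2 / |x|^2]. *)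
Lemma rellich_pointwise x : D x ->
  (W x + (n%:R - 1) * (rsq x)^-1) * grad_sq u x +
    \sum_i partial i (rellich_field u psi i) x <= laplacian u x ^+ 2.
Proof.
move=> Dx; have r0 := rsq0 Dx.
rewrite (div_rellich_field oD su Cpsi rsq0 Dx).
have [_ ->] := derive_grad_coef_grad su r0.
have [_ ->] := derive_x_coef_x su r0 (dpsi Dx).
set r2 := rsq x in r0 *; set g := r2^-1.
have g0 : 0 <= g by rewrite invr_ge0; apply: sumr_ge0 => i _; exact: sqr_ge0.
have gr : g * r2 = 1 by rewrite mulVf.
have n2 : (0 : R) < n%:R - 2.
  by rewrite subr_gt0 ltr_nat (leq_trans _ n5).
set L := laplacian u x; set Q := \sum_i \sum_j _; set q := grad_sq u x.
set b := hess_xx u x; set s := xgrad u x; set uh := hess_xgrad u x.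
set hh := \sum_i hess_x u i x * hess_x u i x.
have tE : tang_sq u x = q - g * s ^+ 2 by rewrite /tang_sq expr2.
have xh : b = \sum_i x ord0 i * hess_x u i x by [].
pose hv i := hess_x u i x; pose U i := partial i u x; pose xv i := x ord0 i.
(* [|H e - f U|^2], with [f = |x| psi] *)
have S1 : 0 <= g * hh - 2 * psi x * uh + r2 * psi x ^+ 2 * q.
  have E : \sum_i (hv i - r2 * psi x * U i) ^+ 2 =
      hh + (- 2 * (r2 * psi x)) * uh + (r2 * psi x) ^+ 2 * q.
    exact: sum_sqr_subZ.
  have := mulr_ge0 g0 (sumr_sqr_ge0 (fun i => hv i - r2 * psi x * U i)).
  by rewrite E; congr (0 <= _); rewrite /g; field.
(* the square of the sum of [T / |x|] and of the radial derivative of [T] *)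
have S2 : 0 <= g * (hh + 2 * uh + q - g * (b + s) ^+ 2).
  have E : \sum_i (hv i + U i - g * (b + s) * xv i) ^+ 2 =
      hh + 2 * uh + q + (- 2 * (g * (b + s))) * b + (- 2 * (g * (b + s))) * s +
      (g * (b + s)) ^+ 2 * r2.
    exact: sum_sqr_addBZ.
  have := mulr_ge0 g0 (sumr_sqr_ge0 (fun i => hv i + U i - g * (b + s) * xv i)).
  by rewrite E; congr (0 <= _); rewrite /g; field.
have S4 : 0 <= g * tang_sq u x.
  have E : \sum_i (U i - g * s * xv i) ^+ 2 =
      q + (- 2 * (g * s)) * s + (g * s) ^+ 2 * r2.
    exact: sum_sqr_subZ.
  have := mulr_ge0 g0 (sumr_sqr_ge0 (fun i => U i - g * s * xv i)).
  by rewrite E tE; congr (0 <= _); rewrite /g; field.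
have S3 : 0 <= ((n%:R - 1) * (Q - 2 * g * hh + g ^+ 2 * b ^+ 2) -
    (L - g * b) ^+ 2) / (n%:R - 2).
  apply: divr_ge0; last exact: ltW.
  rewrite subr_ge0.
  exact: (tangential_trace_le (ltn_trans _ n5)
    (fun i j => congr1 (fun f => f x) (hessC su i j)) (fun i => erefl) gr xh).
have n5' : (0 : R) <= (n%:R - 5) by rewrite subr_ge0 ler_nat.
have := rellich_scalar_identity g L Q hh b s q uh (kappa u x) (theta u x)
   (lt0r_neq0 n2) (riccati Dx).
cbv zeta; rewrite -tE -/r2 => I.
rewrite addrC -lerBrDr I /coef_grad /coef_x -/L -/q -/uh -/b -/g.
rewrite -subr_ge0.
apply: le_trans (addr_ge0 (addr_ge0 (addr_ge0 S1 S2) S3) (mulr_ge0 n5' S4)) _.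
rewrite le_eqVlt; apply/orP; left; apply/eqP.
ring.
Qed.

End pointwise_rellich.

(** * Integration of compactly supported fields *)

Section supported.
Context {R : realType} {n : nat}.
Variables (D K : set 'rV[R]_n).
Hypotheses (cK : closed K) (KD : K `<=` D).
Implicit Types (f : 'rV[R]_n -> R) (x v : 'rV[R]_n).

Definition vanish_off f := forall x, ~ K x -> f x = 0.

Lemma vanish_off_near f x : vanish_off f -> ~ K x -> \near x, f x = 0.
Proof.
move=> f0 Kx; have oK : open (~` K) by exact: closed_openC.
by apply: filterS (open_nbhs_nbhs (conj oK Kx)) => y; exact: f0.
Qed.

Lemma vanish_off_derive f x v : vanish_off f -> ~ K x -> is_derive x v f 0.
Proof.
move=> f0 Kx; apply: (near_eq_is_derive _ (is_derive_cst (0 : R) x v)).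
by apply: filterS (vanish_off_near f0 Kx) => y /esym.
Qed.

Lemma vanish_off_partial f i : vanish_off f -> vanish_off (partial i f).
Proof. by move=> f0 x Kx; exact: (is_derive_partial (vanish_off_derive _ f0 Kx)). Qed.

Lemma vanish_off_continuous f : vanish_off f ->
  (forall x, D x -> {for x, continuous f}) -> continuous f.
Proof.
move=> f0 cf x; have [Dx|Dx] := pselect (D x); first exact: cf.
have Kx : ~ K x by move=> /KD.
rewrite /continuous_at (f0 x Kx).
exact: (@cvg_near_cst _ _ (0 : R) f (nbhs x) _ (vanish_off_near f0 Kx)).
Qed.

Hypothesis coK : compact K.

Lemma vanish_off_far : exists M : R, forall f, vanish_off f ->
  forall x, M < `|x| -> f x = 0.
Proof.
have [M [_ KM]] := compact_bounded coK.
exists (M + 1) => f f0 x Mx; apply: f0 => Kx.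
by move: Mx; rewrite ltNge (KM _ _ _ Kx)// ltrDl.
Qed.

Lemma vanish_off_integrable f : vanish_off f ->
  (forall x, D x -> {for x, continuous f}) ->
  (lebesgue_rV R n).-integrable setT (EFin \o f).
Proof.
move=> f0 cf; have [M MP] := vanish_off_far.
exact: continuous_integrable_rV (vanish_off_continuous f0 cf) (MP _ f0).
Qed.

Lemma integral_div_eq0 (X : 'I_n -> 'rV[R]_n -> R) :
  (forall i, C1on D (X i)) -> (forall i, vanish_off (X i)) ->
  (lebesgue_rV R n).-integrable setT
    (fun x => (\sum_i partial i (X i) x)%:E) /\
  (\int[lebesgue_rV R n]_x (\sum_i partial i (X i) x)%:E = 0)%E.
Proof.
move=> CX X0; have [M MP] := vanish_off_far.
have cp i x : D x -> {for x, continuous (partial i (X i))}.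
  by move=> Dx; exact: ((CX i) x Dx).2.
have p0 i := vanish_off_partial i (X0 i).
have ip i := vanish_off_integrable (p0 i) (cp i).
have -> : (fun x => (\sum_i partial i (X i) x)%:E) =
          (fun x => \sum_i (partial i (X i) x)%:E)%E.
  by apply/funext => x; rewrite sumEFin.
split; first by apply: integrable_sum => // i _; exact: ip.
rewrite integral_sum; [|by []|by move=> i; exact: ip].
rewrite big1// => i _.
apply: (@integral_partial_eq0 _ _ i (X i) _ M).
- move=> x; have [Dx|Dx] := pselect (D x);
    first exact: (C1on_derive _ (CX i) Dx).
  have Kx : ~ K x by move=> /KD.
  by rewrite (p0 i x Kx); exact: vanish_off_derive.
- exact: vanish_off_continuous (p0 i) (cp i).
- exact: MP.
- exact: MP.
Qed.

End supported.

Section rellich.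
Context {R : realType} {n : nat}.
Variables (u psi p V : 'rV[R]_n -> R) (D : set 'rV[R]_n).
Hypotheses (n5 : (5 <= n)%N) (oD : open D) (su : smooth u).
Hypotheses (cu : compact (csupport u)) (uD : csupport u `<=` D).
Hypothesis (Cpsi : C1on D psi).
Hypothesis dpsi : forall x, D x -> is_derive x x psi (p x).
Hypothesis rsq0 : forall x, D x -> rsq x != 0.
Hypothesis cV : forall x, D x -> {for x, continuous V}.
Hypothesis riccati : forall x, D x ->
  p x = - (V x - (n%:R - 1) * (rsq x)^-1) - n%:R * psi x - rsq x * psi x ^+ 2.

Let K := csupport u.
Let cK : closed K. Proof. exact: closed_closure. Qed.

Let u0 : vanish_off K u.
Proof.
move=> x Kx; apply/eqP/negPn/negP => ux; apply: Kx; exact: subset_closure.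
Qed.

Lemma vanish_off_grad i : vanish_off K (partial i u).
Proof. exact: (vanish_off_partial cK i u0). Qed.

Let h0 i j : vanish_off K (hess u i j).
Proof. exact: (vanish_off_partial cK i (vanish_off_grad j)). Qed.

Lemma vanish_off_grad_sq : vanish_off K (grad_sq u).
Proof. by move=> x Kx; apply: big1 => i _; rewrite vanish_off_grad// mul0r. Qed.

Lemma vanish_off_laplacian : vanish_off K (laplacian u).
Proof. by move=> x Kx; apply: big1 => i _; exact: h0. Qed.

Let field0 i : vanish_off K (rellich_field u psi i).
Proof.
move=> x Kx; rewrite /rellich_field (vanish_off_grad i Kx) mulr0 sub0r.
have -> : hess_grad u i x = 0 by apply: big1 => j _; rewrite h0// mul0r.
have -> : coef_x u psi x = 0; last by rewrite mulr0 mul0r oppr0 addr0.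
have hx0 j : hess_x u j x = 0 by apply: big1 => k _; rewrite h0// mul0r.
have xg0 : xgrad u x = 0.
  by apply: big1 => j _; rewrite vanish_off_grad// mulr0.
have uh0 : hess_xgrad u x = 0.
  by apply: big1 => j _; rewrite vanish_off_grad// mul0r.
by rewrite /coef_x /tang_sq uh0 xg0 vanish_off_grad_sq// !(mulr0, subr0, addr0).
Qed.

Lemma continuous_grad_sq x : {for x, continuous (grad_sq u)}.
Proof.
have C : C1on setT (grad_sq u).
  apply: (C1on_sum openT) => i; apply: (C1on_mul openT);
  exact: C1on_smooth (smooth_partial i su).
exact: (C1on_cont C).
Qed.

Lemma integrable_weight_grad_sq (w : 'rV[R]_n -> R) :
  (forall x, D x -> {for x, continuous w}) ->
  (lebesgue_rV R n).-integrable setT (fun x => (w x * grad_sq u x)%:E).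
Proof.
move=> cw; apply: (vanish_off_integrable cK uD cu).
  by move=> x Kx; rewrite vanish_off_grad_sq// mulr0.
move=> x Dx; apply: (@cvgM _ _ (nbhs x)); first exact: cw.
exact: continuous_grad_sq.
Qed.

Lemma rellich_weighted :
  (\int[lebesgue_rV R n]_x (V x * grad_sq u x)%:E <=
   \int[lebesgue_rV R n]_x (laplacian u x ^+ 2)%:E)%E.
Proof.
have [iX X0] := integral_div_eq0 cK uD cu
  (C1on_rellich_field oD su Cpsi rsq0) field0.
have iV := integrable_weight_grad_sq cV.
have iL : (lebesgue_rV R n).-integrable setT (fun x => (laplacian u x ^+ 2)%:E).
  apply: (vanish_off_integrable cK uD cu).
    by move=> x Kx; rewrite vanish_off_laplacian// expr0n.
  move=> x _; rewrite /prop_for; apply: (@cvgM _ _ (nbhs x));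
  apply: (C1on_cont (D := setT)) => //; apply: (C1on_sum openT) => i;
  exact: C1on_smooth (smooth_hess su i i).
rewrite -[leLHS]adde0 -X0.
rewrite -(integralD measurableT iV iX).
apply: le_integral => //; first exact: integrableD.
move=> x _; rewrite -EFinD lee_fin.
have [Dx|Dx] := pselect (D x); last first.
  have Kx : ~ K x by move=> /uD.
  rewrite vanish_off_laplacian// vanish_off_grad_sq// mulr0 add0r.
  by rewrite big1 ?sqr_ge0// => i _; exact: (vanish_off_partial cK i (field0 i)).
have := rellich_pointwise n5 oD su Cpsi dpsi rsq0 riccati Dx.
by rewrite subrK.
Qed.

End rellich.

(** * Radial functions *)

Section radial.
Context {R : realType} {n : nat}.
Implicit Types (x : 'rV[R]_n) (rho : \bar R).

Lemma enormE x : enorm x = Num.sqrt (rsq x).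
Proof. by []. Qed.

Lemma rsq_ge0 x : 0 <= rsq x.
Proof. by apply: sumr_ge0 => i _; exact: sqr_ge0. Qed.

Lemma sqr_enorm x : enorm x ^+ 2 = rsq x.
Proof. by rewrite enormE sqr_sqrtr ?rsq_ge0. Qed.

Lemma enorm_gt0 x : (0 < enorm x) = (x != 0).
Proof.
rewrite enormE sqrtr_gt0 lt0r rsq_ge0 andbT; congr (~~ _).
apply/idP/idP => [|/eqP->]; last first.
  by rewrite /rsq big1// => i _; rewrite mxE mul0r.
rewrite psumr_eq0 => [/allP h|i _]; last exact: sqr_ge0.
apply/eqP/rowP => i; rewrite mxE; apply/eqP.
by have := h i (mem_index_enum _); rewrite /= mulf_eq0 orbb.
Qed.

Lemma open_itv0 rho : open (itv0 rho).
Proof.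
rewrite (_ : itv0 rho = [set s | 0 < s] `&` [set s | (s%:E < rho)%E])//.
apply: openI; first exact: open_gt.
case: rho => [r||].
- under eq_set do rewrite lte_fin; exact: open_lt.
- rewrite (_ : mkset _ = setT); first exact: openT.
  by apply/seteqP; split=> s //= _; exact: ltry.
- rewrite (_ : mkset _ = set0); first exact: open0.
  by apply/seteqP; split=> s //=; rewrite ltNge leNye.
Qed.

Lemma C1on_rsq (D : set 'rV[R]_n) : open D -> C1on D (@rsq R n).
Proof.
move=> oD; apply: (C1on_sum oD) => i.
exact: (C1on_mul oD (C1on_coord i oD) (C1on_coord i oD)).
Qed.

Lemma continuous_enorm : continuous (@enorm R n).
Proof.
move=> x; apply: (@continuous_comp _ _ _ (@rsq R n) Num.sqrt).
  exact: (C1on_cont (C1on_rsq openT)).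
exact: sqrt_continuous.
Qed.

Definition punctured_ball rho : set 'rV[R]_n := @enorm R n @^-1` itv0 rho.

Lemma punctured_ballE rho : punctured_ball rho = eball0 rho `\ 0.
Proof.
apply/seteqP; split=> x /=; rewrite /punctured_ball /itv0 /= enorm_gt0.
  by case=> /eqP x0 xr.
by case=> xr /eqP x0.
Qed.

Lemma open_punctured_ball rho : open (punctured_ball rho).
Proof.
have /continuousP h := @continuous_enorm.
exact: (h _ (@open_itv0 rho)).
Qed.

Lemma rsq_neq0 rho x : punctured_ball rho x -> rsq x != 0.
Proof.
case=> + _; rewrite enormE sqrtr_gt0; exact: lt0r_neq0.
Qed.

Lemma C1on_enorm rho : C1on (punctured_ball rho) (@enorm R n).
Proof.
have oD := @open_punctured_ball rho.
apply: (C1on_comp (p := Num.sqrt) (dp := fun r => (2 * Num.sqrt r)^-1) oD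
  (C1on_rsq oD)) => x Dx.
  by apply: is_derive1_sqrt; rewrite lt0r (rsq_neq0 Dx) rsq_ge0.
have r0 : Num.sqrt (rsq x) != 0 by case: Dx => + _; exact: lt0r_neq0.
apply: (@cvgV _ _ (nbhs (rsq x))); first by rewrite mulf_neq0.
apply: (@cvgM _ _ (nbhs (rsq x))); first exact: cvg_cst.
exact: sqrt_continuous.
Qed.

Lemma derive_x_enorm rho x : punctured_ball rho x ->
  is_derive x x (@enorm R n) (enorm x).
Proof.
move=> Dx; have r0 : 0 < rsq x by rewrite lt0r (rsq_neq0 Dx) rsq_ge0.
have oD := @open_punctured_ball rho.
apply: is_derive_eq.
  exact: (is_derive_comp_real (C1on_diff (C1on_rsq oD) Dx) (derive_x_rsq x)
    (is_derive1_sqrt r0)).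
have e0 : enorm x != 0 by case: Dx => + _; exact: lt0r_neq0.
by rewrite -enormE -sqr_enorm; field.
Qed.

End radial.

Section riccati.
Context {R : realType} {n : nat}.
Variables (u : 'rV[R]_n -> R) (V f : R -> R) (rho : \bar R).
Hypotheses (n5 : (5 <= n)%N) (uc : Cc_infty (eball0 rho `\ 0) u).
Hypothesis cV : forall s, itv0 rho s -> {for s, continuous V}.
Hypothesis df : forall s : R, itv0 rho s -> is_derive s 1 f
  (- (V s - (n%:R - 1) / s ^+ 2) - f s ^+ 2 - (n%:R - 1) * f s / s).

Let D : set 'rV[R]_n := punctured_ball rho.
Let psi (r : R) := f r / r.
Let dpsi (r : R) :=
  (- (V r - (n%:R - 1) / r ^+ 2) - f r ^+ 2 - n%:R * f r / r) / r.

Let dpsiP (s : R) : itv0 rho s -> is_derive s 1 psi (dpsi s).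
Proof.
move=> rs; have s0 : s != 0 by case: rs => + _; exact: lt0r_neq0.
apply: is_derive_eq.
  exact: (is_derive_mul (df rs) (is_derive_inv (f := id) s0 (is_derive_id s 1))).
by rewrite /dpsi; field.
Qed.

Let cf (s : R) : itv0 rho s -> {for s, continuous f}.
Proof.
move=> rs; apply: differentiable_continuous; apply/derivable1_diffP.
by have [] := df rs.
Qed.

Let cdpsi (s : R) : itv0 rho s -> {for s, continuous dpsi}.
Proof.
move=> rs; have s0 : s != 0 by case: rs => + _; exact: lt0r_neq0.
have ci : {for s, continuous (fun r : R => r^-1)}.
  exact: (@cvgV _ _ (nbhs s) _ id s s0 cvg_id).
have ck (k : R) : {for s, continuous (fun _ : R => k)} by exact: cvg_cst.
apply: (@cvgM _ _ (nbhs s)) => //.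
apply: (@cvgB _ _ _ (nbhs s)); last first.
  apply: (@cvgM _ _ (nbhs s)) => //; apply: (@cvgM _ _ (nbhs s));
    first exact: ck.
  exact: cf.
apply: (@cvgB _ _ _ (nbhs s)); last first.
  by apply: (@cvgM _ _ (nbhs s)); exact: cf.
apply: (@cvgN _ _ _ (nbhs s)).
apply: (@cvgB _ _ _ (nbhs s)); first exact: cV.
apply: (@cvgM _ _ (nbhs s)); first exact: ck.
apply: (@cvgV _ _ (nbhs s)); first by rewrite expf_neq0.
by apply: (@cvgM _ _ (nbhs s)); exact: cvg_id.
Qed.

(** The Riccati equation of [f] for the potential [V - (n - 1) / r^2] becomes,
    for the radial function [psi = f / r], the equation that
    [rellich_weighted] requires. *)
Lemma rellich_riccati :
  (\int[lebesgue_rV R n]_x (V (enorm x) * grad_sq u x)%:E <=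
   \int[lebesgue_rV R n]_x (laplacian u x ^+ 2)%:E)%E.
Proof.
have [su cu uD] := uc.
have oD : open D := @open_punctured_ball _ _ rho.
have cenorm x : {for x, continuous (@enorm R n)} by exact: continuous_enorm.
apply: (@rellich_weighted _ _ u (psi \o @enorm R n)
  (fun x => dpsi (enorm x) * enorm x) (fun x => V (enorm x)) D) => //.
- by rewrite /D punctured_ballE.
- exact: (C1on_comp (p := psi) (dp := dpsi) oD (@C1on_enorm _ _ rho)
    (fun x Dx => dpsiP Dx) (fun x Dx => cdpsi Dx)).
- move=> x Dx; apply: is_derive_comp_real (derive_x_enorm Dx) (dpsiP Dx).
  exact: (C1on_diff (@C1on_enorm _ _ rho) Dx).
- by move=> x Dx; exact: rsq_neq0 Dx.
- move=> x Dx; apply: (@continuous_comp _ _ _ (@enorm R n) V) => //.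
  exact: cV.
- move=> x Dx; have x0 : enorm x != 0 by case: Dx => + _; exact: lt0r_neq0.
  by rewrite -sqr_enorm /= /psi /dpsi; field.
Qed.

End riccati.

(** * Bessel pairs *)

(** The logarithmic derivative of a solution of a linear equation of order two
    solves a Riccati equation. *)
Lemma bessel_riccati (R : realType) (n : nat) (rho : \bar R) (W : R -> R) :
  (0 < n)%N -> bessel_pair n rho (fun=> 1) W ->
  exists f : R -> R, forall s : R, itv0 rho s ->
    is_derive s 1 f (- W s - f s ^+ 2 - (n%:R - 1) * f s / s).
Proof.
move=> n0 [_ [phi phiP]].
pose k := n.-1; have nk : n%:R - 1 = k%:R :> R.
  by rewrite /k -subn1 natrB.
pose flux (t : R) := t ^+ k * 1 * (phi^`())%classic t.
(* This is [phi' / phi], but it is the flux that is known to be derivable. *)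
exists (fun t => flux t * (t ^+ k * phi t)^-1) => s rs.
have [phi0 dphi dflux eq] := phiP s rs.
have s0 : s != 0 by case: rs => + _; exact: lt0r_neq0.
have P0 : s ^+ k != 0 by rewrite expf_neq0.
have dP : is_derive s 1 (fun t : R => t ^+ k) (k%:R * (s ^+ k / s)).
  split; first exact: exprn_derivable.
  rewrite exp_derive -[LHS]/(k%:R * s ^+ k.-1 * 1) mulr1.
  case: (k) => [|j] /=; first by rewrite !mul0r.
  by rewrite exprS [s * _]mulrC mulfK.
have dphi' : is_derive s 1 phi ((phi^`())%classic s).
  rewrite derive1E; exact: derivableP.
have dflux' : is_derive s 1 flux (- (s ^+ k * W s * phi s)).
  have <- : (flux^`())%classic s = - (s ^+ k * W s * phi s).
    by apply/eqP; rewrite -addr_eq0; apply/eqP.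
  rewrite derive1E; exact: derivableP.
have Pphi0 : s ^+ k * phi s != 0 by rewrite mulf_neq0// gt_eqF.
have dPphi : is_derive s 1 (fun t : R => t ^+ k * phi t)
  (s ^+ k * (phi^`())%classic s + phi s * (k%:R * (s ^+ k / s))).
  exact: is_derive_mul dP dphi'.
have df := is_derive_mul dflux'
  (is_derive_inv (f := fun t : R => t ^+ k * phi t) Pphi0 dPphi).
apply: (is_derive_eq df).
cbv beta; rewrite nk /flux.
by field; rewrite s0 P0 gt_eqF.
Qed.

Section bessel_inequalities.
Context {R : realType} {N : nat}.
Variables (rho : \bar R) (W : R -> R) (u : 'rV[R]_N -> R).
Hypotheses (N5 : (5 <= N)%N) (uc : Cc_infty (eball0 rho `\ 0) u).
Hypothesis sW : smooth_on (itv0 rho) W.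

Let cW (s : R) : itv0 rho s -> {for s, continuous W}.
Proof.
move=> rs; have dW : derivable W s 1 := @sW 0%N s rs;
  apply: differentiable_continuous.
exact/derivable1_diffP.
Qed.

Let cinv (s : R) : itv0 rho s ->
  {for s, continuous (fun r : R => (N%:R - 1) / r ^+ 2)}.
Proof.
move=> rs; have s0 : s != 0 by case: rs => + _; exact: lt0r_neq0.
apply: (@cvgM _ _ (nbhs s)); first exact: cvg_cst.
apply: (@cvgV _ _ (nbhs s)); first by rewrite expf_neq0.
by apply: (@cvgM _ _ (nbhs s)); exact: cvg_id.
Qed.

(** Adding [1 / s] to [f] lowers the dimension from [N + 2] to [N] and
    subtracts [(N - 1) / s^2] from the potential, which is exactly the term that
    the [N]-dimensional inequality adds. *)
Lemma rellich_bessel_add2 : bessel_pair (N + 2) rho (fun=> 1) W ->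
  (\int[lebesgue_rV R N]_x (W (enorm x) * grad_sq u x)%:E <=
   \int[lebesgue_rV R N]_x (laplacian u x ^+ 2)%:E)%E.
Proof.
move=> /bessel_riccati[|f df]; first by rewrite addn2.
apply: (rellich_riccati (f := fun s => f s + s^-1) N5 uc cW) => s rs.
have s0 : s != 0 by case: rs => + _; exact: lt0r_neq0.
apply: is_derive_eq.
  apply: is_derive_add (df s rs) _.
  exact: (is_derive_inv (f := id) s0 (is_derive_id s 1)).
by rewrite natrD; field.
Qed.

Lemma rellich_bessel : bessel_pair N rho (fun=> 1) W ->
  (\int[lebesgue_rV R N]_x
     ((W (enorm x) + (N%:R - 1) / enorm x ^+ 2) * grad_sq u x)%:E <=
   \int[lebesgue_rV R N]_x (laplacian u x ^+ 2)%:E)%E.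
Proof.
move=> /bessel_riccati[|f df]; first exact: leq_trans N5.
apply: (rellich_riccati (V := fun s => W s + (N%:R - 1) / s ^+ 2) (f := f)
  N5 uc) => s rs.
  by apply: (@cvgD _ _ _ (nbhs s)); [exact: cW|exact: cinv].
by rewrite addrK; exact: df.
Qed.

Lemma integral_eball0 (F : 'rV[R]_N -> R) : vanish_off (csupport u) F ->
  (\int[lebesgue_rV R N]_(x in eball0 rho) (F x)%:E =
   \int[lebesgue_rV R N]_x (F x)%:E)%E.
Proof.
move=> F0; have [_ _ uD] := uc.
rewrite [LHS]integral_mkcond; apply: eq_integral => x _.
rewrite patchE; case: ifPn => //; rewrite notin_setE => nx.
by rewrite F0// => /uD[].
Qed.

Lemma sqr_enorm_gradient x : enorm (gradient u x) ^+ 2 = grad_sq u x.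
Proof. by rewrite sqr_enorm; apply: eq_bigr => i _; rewrite mxE. Qed.

Lemma integral_eball0_laplacian :
  (\int[lebesgue_rV R N]_(x in eball0 rho) (`|laplacian u x| ^+ 2)%:E =
   \int[lebesgue_rV R N]_x (laplacian u x ^+ 2)%:E)%E.
Proof.
rewrite -integral_eball0; last first.
  by move=> x ux; rewrite vanish_off_laplacian// expr0n.
by apply: eq_integral => x _; rewrite real_normK// num_real.
Qed.

Lemma integral_eball0_weight (w : 'rV[R]_N -> R) :
  (\int[lebesgue_rV R N]_(x in eball0 rho)
     (w x * enorm (gradient u x) ^+ 2)%:E =
   \int[lebesgue_rV R N]_x (w x * grad_sq u x)%:E)%E.
Proof.
rewrite -integral_eball0; last first.
  by move=> x ux; rewrite vanish_off_grad_sq// mulr0.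
by apply: eq_integral => x _; rewrite sqr_enorm_gradient.
Qed.

Lemma integral_weight_split :
  (\int[lebesgue_rV R N]_x
     ((W (enorm x) + (N%:R - 1) / enorm x ^+ 2) * grad_sq u x)%:E =
   \int[lebesgue_rV R N]_x (W (enorm x) * grad_sq u x)%:E +
   (N%:R - 1)%:E *
     \int[lebesgue_rV R N]_x ((enorm x ^+ 2)^-1 * grad_sq u x)%:E)%E.
Proof.
have [su cu uD] := uc.
rewrite -punctured_ballE in uD.
have cenorm (x : 'rV[R]_N) : {for x, continuous (@enorm R N)}.
  exact: continuous_enorm.
have i1 := integrable_weight_grad_sq (w := W \o @enorm R N) su cu uD
  (fun x Dx => continuous_comp (cenorm x) (cW Dx)).
have i2 : (lebesgue_rV R N).-integrable setT
    (fun x => ((enorm x ^+ 2)^-1 * grad_sq u x)%:E).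
  apply: (integrable_weight_grad_sq (w := fun x => (enorm x ^+ 2)^-1) su cu uD).
  move=> x Dx; have x0 : enorm x != 0 by case: Dx => + _; exact: lt0r_neq0.
  apply: (@cvgV _ _ (nbhs x)); first by rewrite expf_neq0.
  by apply: (@cvgM _ _ (nbhs x)); exact: cenorm.
rewrite -(integralZl measurableT i2).
rewrite -(integralD measurableT i1 (integrableZl measurableT _ i2)).
by apply: eq_integral => x _; rewrite -EFinM -EFinD mulrDl mulrA.
Qed.

End bessel_inequalities.

Theorem corollary1p1 (R : realType) (N : nat) (rho : \bar R) (W2 : R -> R)
    (hN : (5 <= N)%N) (hrho : (0 < rho)%E)
    (hW2 : smooth_on (itv0 rho) W2) :
  (bessel_pair (N + 2) rho (fun=> 1) W2 ->
   forall u : 'rV[R]_N -> R, Cc_infty (eball0 rho `\ 0) u ->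
     (\int[lebesgue_rV R N]_(x in eball0 rho) (`|laplacian u x| ^+ 2)%:E >=
      \int[lebesgue_rV R N]_(x in eball0 rho)
        (W2 (enorm x) * enorm (gradient u x) ^+ 2)%:E)%E)
  /\
  (bessel_pair N rho (fun=> 1) W2 ->
   forall u : 'rV[R]_N -> R, Cc_infty (eball0 rho `\ 0) u ->
     (\int[lebesgue_rV R N]_(x in eball0 rho) (`|laplacian u x| ^+ 2)%:E >=
      \int[lebesgue_rV R N]_(x in eball0 rho)
        (W2 (enorm x) * enorm (gradient u x) ^+ 2)%:E +
      (N%:R - 1)%:E *
      \int[lebesgue_rV R N]_(x in eball0 rho)
        (enorm (gradient u x) ^+ 2 / enorm x ^+ 2)%:E)%E).
Proof.
split=> bp u uc; rewrite (integral_eball0_laplacian uc).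
  rewrite (integral_eball0_weight uc (W2 \o @enorm R N)).
  exact: rellich_bessel_add2 hN uc hW2 bp.
have -> : (\int[lebesgue_rV R N]_(x in eball0 rho)
    (enorm (gradient u x) ^+ 2 / enorm x ^+ 2)%:E =
  \int[lebesgue_rV R N]_(x in eball0 rho)
    ((enorm x ^+ 2)^-1 * enorm (gradient u x) ^+ 2)%:E)%E.
  by apply: eq_integral => x _; rewrite mulrC.
rewrite (integral_eball0_weight uc (W2 \o @enorm R N)).
rewrite (integral_eball0_weight uc (fun x => (enorm x ^+ 2)^-1)).
rewrite -(integral_weight_split uc hW2).
exact: rellich_bessel hN uc hW2 bp.
Qed.
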